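(* Let $\sigma$ be a triangulation of a polygon with $n\ge3$ vertices, identify the vertex set of $Q_\sigma$ with $\{1,\dots,2n-3\}$, and regard $\Gamma_\sigma$ as an $R$-algebra via $x\mapsto C$. For vertices $i,j,k$ put $d^i_{k,j}=(\ell^\theta_{k,i}+\ell^\theta_{i,j}-\ell^\theta_{k,j})/n$ (a non-negative integer). Then for every vertex $k$, $\Gamma_\sigma$ is isomorphic as an $R$-algebra to the tiled $R$-order $\big((x^{d^i_{k,j}}R)\big)_{i,j\in\{1,\dots,2n-3\}}\subset M_{2n-3}(R)$.
   Context: $K$ a field, $R=K[x]$. $P$: regular polygon with vertices $P_1,\dots,P_n$ counterclockwise; $\sigma$: triangulation (maximal set of non-crossing diagonals). $Q_\sigma$: vertices = edges of $\sigma$; internal arrows $a\to b$ when $a,b$ bound a common triangle and $a$ precedes $b$ anticlockwise around the common vertex; external arrows $a\to b$ between the two sides of $P$ at each polygon vertex incident to a diagonal, anticlockwise. $W_\sigma=\sum$(cyclic triangles)$-\sum$(big cycles: internal arrows plus one external arrow around a polygon vertex); $F$ = vertices given by sides; $\Gamma_\sigma=KQ_\sigma/J$, $J$ generated by cyclic derivatives $\partial_aW_\sigma$ for arrows with source or target not in $F$. $C=\sum_iC_i$ where $C_i$ is the common class in $\Gamma_\sigma$ of the minimal cycles through $i$. $\theta$-length: an internal arrow $i\to j$ has $\theta$-length $t$ if the angle between edges $i,j$ in their triangle is $t\pi/n$; external arrows have $\theta$-length $2$; additive on paths. $\ell^\theta_{i,j}$ is the minimal $\theta$-length of a path from $i$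 to $j$ in $Q_\sigma$. A tiled $R$-order is an $R$-order of the form $((x^{a_{ij}}R))\subset M_m(K(x))$ with $a_{ij}+a_{jt}\ge a_{it}$. *)

(* Defs.v *)
From HB Require Import structures.
From mathcomp Require Import all_boot all_order all_algebra.
Set Implicit Arguments. Unset Strict Implicit. Unset Printing Implicit Defensive.
Import GRing.Theory.

(* Polygon vertices P_1..P_n are 0..n-1 (counterclockwise).  An edge (side or
   diagonal) {P_a,P_b} is the pair (a,b) with a < b. *)
Definition pvert := (nat * nat)%type.

Definition is_side (n : nat) (e : pvert) : bool :=
  [&& e.1 < e.2, e.2 < n & (e.2 == e.1.+1) || ((e.1 == 0) && (e.2 == n.-1))].

Definition is_diag (n : nat) (e : pvert) : bool :=
  [&& e.1 < e.2, e.2 < n & ~~ is_side n e].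

Definition crossing (e f : pvert) : bool :=
  [&& e.1 < f.1, f.1 < e.2 & e.2 < f.2] || [&& f.1 < e.1, e.1 < f.2 & f.2 < e.2].

Definition triangulation (n : nat) (s : seq pvert) : Prop :=
  [/\ all (is_diag n) s,
      {in s &, forall d d', ~~ crossing d d'} &
      forall d, is_diag n d -> d \notin s -> has (crossing d) s].

(* edges of sigma = sides of P and diagonals of sigma = vertices of Q_sigma *)
Definition is_edge (n : nat) (s : seq pvert) (e : pvert) : bool :=
  is_side n e || (e \in s).

Definition mkedge (a b : nat) : pvert := (minn a b, maxn a b).

Definition edges (n : nat) (s : seq pvert) : seq pvert :=
  filter (is_edge n s) (allpairs pair (iota 0 n) (iota 0 n)).

Definition tri_ok (n : nat) (s : seq pvert) (t : nat * nat * nat) : bool :=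
  let: (p, q, r) := t in
  [&& p < q, q < r, is_edge n s (p, q), is_edge n s (q, r) & is_edge n s (p, r)].

Definition triangles (n : nat) (s : seq pvert) : seq (nat * nat * nat) :=
  filter (tri_ok n s)
    (allpairs pair (allpairs pair (iota 0 n) (iota 0 n)) (iota 0 n)).

(* An arrow is recorded as (source, target, theta-length).
   Internal arrows of the triangle p<q<r (anticlockwise around the common
   vertex; the angle at a vertex is (number of sides of the opposite arc)*pi/n):
     at p : (p,q) -> (p,r), length r-q
     at r : (p,r) -> (q,r), length q-p
     at q : (q,r) -> (p,q), length n-r+p                                   *)
Definition tri_arrows (n : nat) (t : nat * nat * nat) : seq (pvert * pvert * nat) :=
  let: (p, q, r) := t in
  [:: ((p, q), (p, r), r - q); ((p, r), (q, r), q - p); ((q, r), (p, q), n - r + p)].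

Definition has_diag (s : seq pvert) (v : nat) : bool :=
  has (fun d : pvert => (d.1 == v) || (d.2 == v)) s.

Definition side_fwd (n v : nat) : pvert := mkedge v (v.+1 %% n).
Definition side_bwd (n v : nat) : pvert := mkedge ((v + n.-1) %% n) v.

(* external arrows: at each vertex incident to a diagonal, from side {v-1,v}
   to side {v,v+1} (anticlockwise around v, through the exterior of P),
   theta-length 2; it closes the chain of internal arrows around v
   {v,v+1} -> ... -> {v-1,v} into the big cycle *)
Definition ext_arrows (n : nat) (s : seq pvert) : seq (pvert * pvert * nat) :=
  [seq (side_bwd n v, side_fwd n v, 2) | v <- iota 0 n & has_diag s v].

Definition arrows (n : nat) (s : seq pvert) : seq (pvert * pvert * nat) :=
  flatten [seq tri_arrows n t | t <- triangles n s] ++ ext_arrows n s.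

Definition is_arrow (n : nat) (s : seq pvert) (e f : pvert) : bool :=
  has (fun a : pvert * pvert * nat => (a.1.1 == e) && (a.1.2 == f)) (arrows n s).

Definition theta (n : nat) (s : seq pvert) (e f : pvert) : nat :=
  (nth (e, f, 0) (arrows n s)
     (find (fun a : pvert * pvert * nat => (a.1.1 == e) && (a.1.2 == f)) (arrows n s))).2.

(* A path is given by its sequence of vertices x0 :: xs (arrows x_i -> x_{i+1});
   (x0, [::]) is the trivial path e_{x0}.  Composition p * q = "p then q". *)
Definition qpath := (pvert * seq pvert)%type.

Definition valid_path (n : nat) (s : seq pvert) (p : qpath) : bool :=
  is_edge n s p.1 && path (is_arrow n s) p.1 p.2.

Definition tgt (p : qpath) : pvert := last p.1 p.2.

Definition theta_len (n : nat) (s : seq pvert) (p : qpath) : nat :=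
  sumn (pairmap (theta n s) p.1 p.2).

Definition min_theta_len (n : nat) (s : seq pvert) (ell : pvert -> pvert -> nat) : Prop :=
  forall e f, is_edge n s e -> is_edge n s f ->
    (exists p, [/\ valid_path n s p, p.1 = e, tgt p = f & theta_len n s p = ell e f]) /\
    (forall p, valid_path n s p -> p.1 = e -> tgt p = f -> ell e f <= theta_len n s p).

(* a cycle [c0; ...; c_{k-1}] stands for c0 -> c1 -> ... -> c_{k-1} -> c0 *)
Definition tri_cycle (t : nat * nat * nat) : seq pvert :=
  let: (p, q, r) := t in [:: (p, q); (p, r); (q, r)].

(* edges at v in anticlockwise order, from side {v,v+1} to side {v-1,v};
   with the external arrow this is the big cycle around v *)
Definition big_cycle (n : nat) (s : seq pvert) (v : nat) : seq pvert :=
  [seq e <- [seq mkedge v ((v + i) %% n) | i <- iota 1 n.-1] | is_edge n s e].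

(* (true, c) : +c ; (false, c) : -c *)
Definition potential (n : nat) (s : seq pvert) : seq (bool * seq pvert) :=
  [seq (true, tri_cycle t) | t <- triangles n s] ++
  [seq (false, big_cycle n s v) | v <- iota 0 n & has_diag s v].

Local Open Scope ring_scope.

(* elements of KQ as formal finite linear combinations of paths *)
Definition coef (K : fieldType) (u : seq (K * qpath)) (p : qpath) : K :=
  \sum_(x <- u | x.2 == p) x.1.

Definition cyc_deriv (K : fieldType) (e f : pvert) (sc : bool * seq pvert)
  : seq (K * qpath) :=
  let c := sc.2 in
  [seq ((if sc.1 then 1 else -1), (head e (rot i.+1 c), behead (rot i.+1 c)))
   | i <- iota 0 (size c)
   & (nth e c i == e) && (nth e c (i.+1 %% size c)%N == f)].

Definition wrel (K : fieldType) (n : nat) (s : seq pvert) (e f : pvert) : seq (K * qpath) :=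
  flatten [seq cyc_deriv K e f sc | sc <- potential n s].

Definition rel_arrow (n : nat) (s : seq pvert) (e f : pvert) : bool :=
  is_arrow n s e f && ~~ (is_side n e && is_side n f).

Definition pcat (p q : qpath) : qpath := (p.1, p.2 ++ q.2).

(* p * u * q in KQ (non-composable products vanish) *)
Definition sandwich (K : fieldType) (p : qpath) (u : seq (K * qpath)) (q : qpath)
  : seq (K * qpath) :=
  [seq (x.1, pcat (pcat p x.2) q) | x <- u & (tgt p == x.2.1) && (tgt x.2 == q.1)].

(* generic element sum_k c_k p_k (partial_{a_k} W) q_k of the ideal J *)
Definition jelem (K : fieldType) (n : nat) (s : seq pvert)
  (g : seq (K * qpath * (pvert * pvert) * qpath)) : seq (K * qpath) :=
  flatten [seq (let: (c, p, a, q) := x in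
                [seq (c * y.1, y.2) | y <- sandwich p (wrel K n s a.1 a.2) q]) | x <- g].

Definition valid_gens (K : fieldType) (n : nat) (s : seq pvert)
  (g : seq (K * qpath * (pvert * pvert) * qpath)) : bool :=
  all (fun x => let: (c, p, a, q) := x in
         [&& valid_path n s p, valid_path n s q & rel_arrow n s a.1 a.2]) g.

(* a minimal cycle through e: the cycle of (the first) triangle containing e,
   starting and ending at e *)
Definition min_cycle (n : nat) (s : seq pvert) (e : pvert) : qpath :=
  let c := tri_cycle (nth (0, 0, 0)%N (triangles n s)
                        (find (fun t => e \in tri_cycle t) (triangles n s))) in
  let c' := rot (index e c) c in (e, rcons (behead c') e).

Definition Cfs (K : fieldType) (n : nat) (s : seq pvert) : seq (K * qpath) :=
  [seq (1, min_cycle n s e) | e <- edges n s].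

(* given by images Ev of the idempotents e_v and Av of the arrows *)
Definition phi_path (K : fieldType) (m : nat) (Ev : pvert -> 'M[{poly K}]_m)
  (Av : pvert -> pvert -> 'M[{poly K}]_m) (p : qpath) : 'M[{poly K}]_m :=
  foldl (fun M ab => M *m Av ab.1 ab.2) (Ev p.1) (zip (p.1 :: p.2) p.2).

Definition phi (K : fieldType) (m : nat) (Ev : pvert -> 'M[{poly K}]_m)
  (Av : pvert -> pvert -> 'M[{poly K}]_m) (u : seq (K * qpath)) : 'M[{poly K}]_m :=
  \sum_(x <- u) x.1%:P *: phi_path Ev Av x.2.

(* (Ev, Av) defines a unital K-algebra homomorphism KQ -> M_m(K[x]) *)
Definition path_alg_hom (K : fieldType) (n : nat) (s : seq pvert) (m : nat)
  (Ev : pvert -> 'M[{poly K}]_m) (Av : pvert -> pvert -> 'M[{poly K}]_m) : Prop :=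
  [/\ forall e f, is_edge n s e -> is_edge n s f ->
        Ev e *m Ev f = (if e == f then Ev e else 0),
      \sum_(e <- edges n s) Ev e = 1%:M &
      forall e f, is_arrow n s e f -> Ev e *m Av e f = Av e f /\ Av e f *m Ev f = Av e f].

Definition tiled_order (K : fieldType) (m : nat) (a : 'I_m -> 'I_m -> nat)
  (M : 'M[{poly K}]_m) : Prop :=
  forall i j, 'X^(a i j) %| M i j.

(* Gamma_sigma = KQ/J is isomorphic, as an R-algebra (x acting as C), to the
   tiled order with exponents a: by the first isomorphism theorem, there is a
   K-algebra homomorphism KQ -> M_m(R) with image the tiled order, kernel J,
   sending C to x. *)
Definition Gamma_iso_tiled (K : fieldType) (n : nat) (s : seq pvert) (m : nat)
  (a : 'I_m -> 'I_m -> nat) : Prop :=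
  exists (Ev : pvert -> 'M[{poly K}]_m) (Av : pvert -> pvert -> 'M[{poly K}]_m),
    [/\ path_alg_hom n s Ev Av,
        forall u : seq (K * qpath), all (fun x => valid_path n s x.2) u ->
          (phi Ev Av u = 0 <->
           exists g, @valid_gens K n s g /\ forall p, coef u p = coef (@jelem K n s g) p),
        forall M, tiled_order a M <->
          exists u : seq (K * qpath), all (fun x => valid_path n s x.2) u /\ phi Ev Av u = M
      & phi Ev Av (@Cfs K n s) = ('X : {poly K})%:M].

Definition dexp (n m : nat) (lab : 'I_m -> pvert) (ell : pvert -> pvert -> nat)
  (k i j : 'I_m) : nat :=
  ((ell (lab k) (lab i) + ell (lab i) (lab j) - ell (lab k) (lab j)) %/ n)%N.

(* Main.v *)
(** An arrow of [Q_sigma] moves one endpoint of an edge anticlockwise, and its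
    theta-length is the number of polygon sides travelled by that endpoint.  Hence
    the theta-length of a path is determined modulo [n] by its ends, and the
    minimal length [ell i j] is the least total displacement of the two endpoints
    over both ways of matching them; the bound is attained because some arrow into
    [j] always lies on a shortest displacement.

    The relations identify the rest of a triangle with the rest of a big cycle,
    two parallel paths of the same theta-length.  Conversely, parallel paths of the
    same length are congruent modulo [J], by induction on the length: if their last
    arrows differ, these turn around the two ends [u], [v] of the target, and a
    displacement estimate leaves room for a path that ends with two sides of a
    triangle on [{u, v}], which a relation rewrites to end with the other arrow.

    So [Gamma_sigma] has a basis indexed by triples [(i, j, ell i j + n t)], and
    [p : i -> j |-> x^((ell k i + theta p - ell k j) / n) E_ij] is an isomorphism
    onto the tiled order. *)
Require Import Defs.
From mathcomp Require Import all_boot all_order all_algebra.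
From mathcomp Require Import zify.
Set Implicit Arguments. Unset Strict Implicit. Unset Printing Implicit Defensive.

(** * Edges as unordered pairs and the cyclic order of the polygon vertices *)

Lemma mkedgeC a b : mkedge a b = mkedge b a.
Proof. by rewrite /mkedge minnC maxnC. Qed.

Lemma mkedge_lt a b : a < b -> mkedge a b = (a, b).
Proof. by move=> ab; rewrite /mkedge; congr pair; lia. Qed.

Lemma mkedge_inj a b c d :
  mkedge a b = mkedge c d -> (a = c /\ b = d) \/ (a = d /\ b = c).
Proof. by rewrite /mkedge => -[]; lia. Qed.

Lemma mkedge_inj_l a b c : mkedge a b = mkedge a c -> b = c.
Proof. by move/mkedge_inj; lia. Qed.

Definition ccw (u v w : nat) : bool :=
  [|| u < v < w, v < w < u | w < u < v].

Section Polygon.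
Variable n : nat.
Hypothesis n3 : 3 <= n.

(** The number of sides travelled anticlockwise from [u] to [v]. All angles and theta-lengths below
    are expressed through it. *)
Definition carc (u v : nat) : nat := if u <= v then v - u else v + n - u.

Definition cnext (v : nat) : nat := if v.+1 == n then 0 else v.+1.

Lemma cnext_spec v :
  (v.+1 = n /\ cnext v = 0) \/ (v.+1 <> n /\ cnext v = v.+1).
Proof. by rewrite /cnext; case: eqP; auto. Qed.

Lemma carc_spec u v :
  (u <= v /\ carc u v = v - u) \/ (v < u /\ carc u v = v + n - u).
Proof. by rewrite /carc; case: leqP; auto. Qed.

Lemma cnextE v : v < n -> v.+1 %% n = cnext v.
Proof.
rewrite /cnext; case: eqP => [<- _|ne v_n]; first by rewrite modnn.
by rewrite modn_small //; lia.
Qed.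

Lemma cnext_ltn v : v < n -> cnext v < n.
Proof. by rewrite /cnext; case: eqP; lia. Qed.

Lemma prvE v : v < n -> (v + n.-1) %% n < n /\ cnext ((v + n.-1) %% n) = v.
Proof.
move=> v_n; have n0 : 0 < n by lia.
split; first by rewrite ltn_mod.
rewrite -cnextE ?ltn_mod // -addn1 modnDml -addnA addn1 prednK //.
by rewrite modnDr modn_small.
Qed.

Lemma cnext_inj u v : u < n -> v < n -> cnext u = cnext v -> u = v.
Proof. by rewrite /cnext; do 2!case: eqP; lia. Qed.

End Polygon.

(** Each [cnext] and [carc] is replaced by its two-case linear description, so that a statement
    about cyclic order becomes linear arithmetic. *)
Ltac geo :=
  unfold ccw, mkedge, crossing in *; simpl fst in *; simpl snd in *;
  repeat match goal with
  | H : context [cnext ?n ?v] |- _ =>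
      pose proof (cnext_spec n v); generalize dependent (cnext n v); intros
  | |- context [cnext ?n ?v] =>
      pose proof (cnext_spec n v); generalize dependent (cnext n v); intros
  | H : context [carc ?n ?u ?v] |- _ =>
      pose proof (carc_spec n u v); generalize dependent (carc n u v); intros
  | |- context [carc ?n ?u ?v] =>
      pose proof (carc_spec n u v); generalize dependent (carc n u v); intros
  end; lia.


(** * Triangles of the triangulation, and arrows as turns around polygon vertices *)

Section Triangulation.
Variables (n : nat) (s : seq pvert).
Hypotheses (n3 : 3 <= n) (triP : triangulation n s).

Local Notation arc := (carc n).
Local Notation nxt := (cnext n).

Definition adj (u v : nat) : bool := is_edge n s (mkedge u v).

Lemma adjC u v : adj u v = adj v u.
Proof. by rewrite /adj mkedgeC. Qed.

Lemma is_edge_lt e : is_edge n s e -> e.1 < e.2 < n.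
Proof.
case: triP => /allP diag_s _ _ /orP[/and3P[-> -> _] // | /diag_s].
by case/and3P=> -> ->.
Qed.

Lemma is_edgeE e : is_edge n s e -> exists u v, e = mkedge u v.
Proof.
by move/is_edge_lt=> /andP[lt_e _]; exists e.1, e.2; rewrite mkedge_lt //; case: e lt_e.
Qed.

Lemma adj_lt u v : adj u v -> [/\ u < n, v < n & u <> v].
Proof. by move/is_edge_lt; split; geo. Qed.

Lemma adj_nxt u : u < n -> adj u (nxt u).
Proof.
move=> u_n; apply/orP; left; rewrite /is_side; geo.
Qed.

Lemma sideP u v : u < n -> v < n -> is_side n (mkedge u v) <-> v = nxt u \/ u = nxt v.
Proof.
move=> u_n v_n; rewrite /is_side; geo.
Qed.

(** Two edges that separate each other's ends cannot be sides, so both are diagonals of [s] and the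
    non-crossing hypothesis applies. The cyclic form avoids any choice of which end is smaller. *)
Lemma adj_noncrossing a b c d :
  adj a b -> adj c d -> ccw a c b -> ccw b d a -> False.
Proof.
move=> ab cd acb bda.
have [a_n b_n _] := adj_lt ab; have [c_n d_n _] := adj_lt cd.
have Nab : ~~ is_side n (mkedge a b).
  by apply/negP=> /(sideP a_n b_n); move: acb bda; geo.
have Ncd : ~~ is_side n (mkedge c d).
  by apply/negP=> /(sideP c_n d_n); move: acb bda; geo.
case: triP => _ nc _.
move: ab cd; rewrite /adj /is_edge (negPf Nab) (negPf Ncd) /= => ab cd.
have := nc _ _ ab cd; by move: acb bda; geo.
Qed.

(** Maximality of the triangulation enters here. If [{w, v}] were missing, some diagonal of [s]
    would cross it. Its end outside the arc from [w] to [v] is either [u], excluded because no edge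
    at [u] lies between, or it makes the diagonal cross [{u, w}] or [{u, v}]. *)
Lemma fan_triangle u w v : adj u w -> adj u v -> ccw u w v ->
  (forall x, adj u x -> ~~ ccw w x v) -> adj w v.
Proof.
move=> uw uv uwv none.
have [u_n w_n _] := adj_lt uw; have [_ v_n _] := adj_lt uv.
case: (boolP (adj w v)) => // Nwv; exfalso.
have [_ _ maxs] := triP.
have diag_wv : is_diag n (mkedge w v).
  move: Nwv; rewrite /adj /is_edge negb_or => /andP[Ns _].
  by rewrite /is_diag Ns /mkedge /=; move: uwv; geo.
have Nin : mkedge w v \notin s by move: Nwv; rewrite /adj /is_edge negb_or => /andP[].
have [d d_s cr] := hasP (maxs _ diag_wv Nin).
have [a [b [wav vbw ab]]] : exists a b, [/\ ccw w a v, ccw v b w & adj a b].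
  have Ed : is_edge n s d by rewrite /is_edge d_s orbT.
  have lt_d := is_edge_lt Ed.
  have Ed1 : d = mkedge d.1 d.2 by rewrite mkedge_lt ?(proj1 (andP lt_d)) //; case: (d).
  case w1: (ccw w d.1 v); [exists d.1, d.2 | exists d.2, d.1]; split=> //.
  - by move: cr w1; geo.
  - by rewrite /adj -Ed1.
  - by move: cr w1 uwv; geo.
  - by move: cr w1 uwv; geo.
  - by rewrite adjC /adj -Ed1.
have [a_n b_n _] := adj_lt ab.
have Nub : b <> u by move=> bu; move: (none a); rewrite adjC -bu ab wav => /(_ isT).
have [vbu | ubw] : ccw v b u \/ ccw u b w.
  by move: vbw uwv Nub; geo.
- by apply: (adj_noncrossing uv ab) => //; move: wav uwv; geo.
- rewrite adjC in ab.
  by apply: (adj_noncrossing uw ab) => //; move: wav uwv; geo.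
Qed.

(* Every arrow turns around a polygon vertex [u], from [{u, w}] to [{u, v}], and
   its theta-length is [arc w v]: the turn is [inner] for an internal arrow and
   [outer] for an external one. *)
Definition inner (u w v : nat) : Prop := [/\ ccw u w v, adj u w, adj w v & adj u v].

Definition outer (u w v : nat) : Prop :=
  [/\ has_diag s u, u < n, w < n, u = nxt w & v = nxt u].

Definition turn (u w v : nat) : Prop := inner u w v \/ outer u w v.

(** Take the neighbour [w] of [u] that comes last before [v]. One exists because [nxt u] is a
    candidate when [v] differs from it. *)
Lemma fan_inner u v : adj u v -> v <> nxt u -> exists w, inner u w v.
Proof.
move=> uv Nv; have [u_n v_n Nuv] := adj_lt uv.
have n_u := cnext_ltn n3 u_n.
pose P (w : 'I_n) := adj u w && (arc u w < arc u v).
have P0 : P (Ordinal n_u).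
  rewrite /P /= adj_nxt //=; move: Nv; geo.
case: (arg_maxnP (fun w : 'I_n => arc u w) P0) => w /andP[uw lt_wv] max_w.
have [_ w_n Nuw] := adj_lt uw.
have uwv : ccw u w v.
  by move: lt_wv; geo.
have none : forall x, adj u x -> ~~ ccw w x v.
  move=> x ux; have [_ x_n Nux] := adj_lt ux; apply/negP=> wxv.
  have Px : P (Ordinal x_n).
    by rewrite /P /= ux /=; move: uwv wxv; geo.
  have /= := max_w _ Px; move: uwv wxv; geo.
exists (val w); split=> //; exact: (fan_triangle uw uv).
Qed.

Lemma inner_rot u w v : inner u w v -> inner w v u.
Proof.
case=> uwv uw wv uv; split=> //; rewrite 1?adjC //.
by move: uwv; geo.
Qed.

Lemma edge_inner e : is_edge n s e -> exists u w v, e = mkedge u v /\ inner u w v.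
Proof.
move=> Ee; have [u [v def_e]] := is_edgeE Ee; rewrite def_e in Ee *.
have [u_n v_n Nuv] := adj_lt Ee.
have [vu | Nv] := eqVneq v (nxt u).
  (* A side has its triangle on one side only. As [n >= 3], [v = nxt u] excludes [u = nxt v], so
     [fan_inner] applies from the other end. *)
  have Nu : u <> nxt v by move: vu; geo.
  have [|w I] := fan_inner _ Nu; first by rewrite adjC.
  by exists v, w, u; rewrite mkedgeC.
have [|w I] := fan_inner Ee; first exact/eqP.
by exists u, w, v.
Qed.

Lemma inner_triangles u w v : inner u w v -> exists2 t, t \in triangles n s &
  (mkedge u w, mkedge u v, arc w v) \in tri_arrows n t.
Proof.
case=> uwv uw wv uv.
have [u_n w_n _] := adj_lt uw; have [_ v_n _] := adj_lt uv.
have trs p q r : p < q -> q < r -> adj p q -> adj q r -> adj p r ->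
    (p, q, r) \in triangles n s.
  move=> pq qr apq aqr apr; have [_ r_n _] := adj_lt apr.
  rewrite /triangles mem_filter /= pq qr.
  move: apq aqr apr; rewrite /adj !mkedge_lt ?(ltn_trans pq qr) // => -> -> -> /=.
  apply/allpairsP; exists ((p, q), r); split=> //=; last by rewrite mem_iota; lia.
  by apply/allpairsP; exists (p, q); split; rewrite ?mem_iota //=; lia.
(* [triangles] stores sorted triples. The three rotations of the cyclic order decide which of the
   three arrows of the triple turns around [u]. *)
case/or3P: uwv => /andP[lt1 lt2].
- exists (u, w, v); first exact: trs.
  rewrite !mkedge_lt ?(ltn_trans lt1 lt2) // inE; apply/orP; left; apply/eqP; congr (_, _).
  by geo.
- exists (w, v, u); first by apply: trs => //; rewrite adjC.
  rewrite ![mkedge u _]mkedgeC !mkedge_lt ?(ltn_trans lt1 lt2) // !inE.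
  apply/orP; right; apply/orP; left; apply/eqP; congr (_, _).
  by geo.
- exists (v, u, w); first by apply: trs => //; rewrite adjC.
  rewrite [mkedge u v]mkedgeC !mkedge_lt // !inE.
  do 2!(apply/orP; right); apply/eqP; congr (_, _).
  by geo.
Qed.

Lemma triangles_inner t : t \in triangles n s -> inner t.1.1 t.1.2 t.2.
Proof.
case: t => -[p q] r; rewrite /triangles mem_filter => /andP[/and5P[pq qr apq aqr apr] _] /=.
by split; rewrite /adj ?mkedge_lt // ?(ltn_trans pq qr) // /ccw pq qr.
Qed.

Lemma tri_arrows_inner t a : t \in triangles n s -> a \in tri_arrows n t ->
  exists u w v, inner u w v /\ a = (mkedge u w, mkedge u v, arc w v).
Proof.
move=> t_tri; have pq : t.1.1 < t.1.2 < t.2.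
  by move: t_tri; case: t => -[p q] r; rewrite mem_filter => /andP[/and5P[-> ->]].
have := triangles_inner t_tri; case: t pq {t_tri} => -[p q] r /= /andP[pq qr] I.
have pr := ltn_trans pq qr.
have J := inner_rot I; have H := inner_rot J.
have [_ _ /adj_lt[_ r_n _] _] := I.
rewrite !inE => /or3P[] /eqP->.
- by exists p, q, r; split=> //; rewrite !mkedge_lt //; congr (_, _); geo.
- exists r, p, q; split=> //; rewrite ![mkedge r _]mkedgeC !mkedge_lt //.
  by congr (_, _); geo.
- exists q, r, p; split=> //; rewrite [mkedge q p]mkedgeC !mkedge_lt //.
  by congr (_, _); geo.
Qed.

Lemma side_bwdE v : v < n -> exists w, [/\ w < n, v = nxt w & side_bwd n v = mkedge v w].
Proof.
move=> v_n; have [p_n pE] := prvE n3 v_n.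
by exists ((v + n.-1) %% n); rewrite /side_bwd mkedgeC.
Qed.

Lemma turn_lt u w v : turn u w v -> [/\ u < n, w < n, v < n & [/\ u <> w, u <> v & w <> v]].
Proof.
case=> [[uwv uw wv uv] | [_ u_n w_n uE vE]].
  by case: (adj_lt uw) => ? ? ?; case: (adj_lt uv) => _ ? ?; case: (adj_lt wv).
have v_n : v < n by rewrite vE cnext_ltn.
by split=> //; move: uE vE; split; geo.
Qed.

Lemma turn_adj u w v : turn u w v -> adj u w /\ adj u v.
Proof.
case=> [[]// | [_ u_n w_n uE vE]].
by rewrite vE adj_nxt // adjC uE adj_nxt.
Qed.

Lemma arrowsP a : a \in arrows n s <->
  exists u w v, turn u w v /\ a = (mkedge u w, mkedge u v, arc w v).
Proof.
rewrite /arrows mem_cat; split=> [/orP[/flattenP[l /mapP[t t_tri ->]] | /mapP[v]] | ].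
- by move=> /(tri_arrows_inner t_tri)[u [w [v [I ->]]]]; exists u, w, v; split=> //; left.
- rewrite mem_filter mem_iota => /andP[hd v_n] ->.
  have {}v_n : v < n by lia.
  have [w [w_n vE ->]] := side_bwdE v_n.
  exists v, w, (nxt v); split; first by right.
  rewrite /side_fwd cnextE //; congr (_, _); move: vE; geo.
- case=> u [w [v [[I | O] ->]]]; apply/orP; [left | right].
    have [t t_tri at_t] := inner_triangles I.
    by apply/flattenP; exists (tri_arrows n t) => //; apply: map_f.
  case: O => hd u_n w_n uE vE; apply/mapP; exists u.
    by rewrite mem_filter hd mem_iota; lia.
  have [w' [w'_n uE' ->]] := side_bwdE u_n.
  have -> : w' = w by apply: (@cnext_inj n); rewrite //  -uE -uE'.
  rewrite /side_fwd cnextE //  -vE; congr (_, _); move: uE vE.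
  geo.
Qed.

Lemma is_arrowP e f : is_arrow n s e f <->
  exists u w v, [/\ turn u w v, e = mkedge u w & f = mkedge u v].
Proof.
split=> [/hasP[a /arrowsP[u [w [v [T ->]]]] /= /andP[/eqP<- /eqP<-]] | ].
  by exists u, w, v.
case=> u [w [v [T -> ->]]]; apply/hasP; exists (mkedge u w, mkedge u v, arc w v).
  by apply/arrowsP; exists u, w, v.
by rewrite /= !eqxx.
Qed.

(** [theta] reads the first recorded arrow between the two edges. The choice does not matter: two
    distinct edges share at most one vertex, so the ends of an arrow determine its turn. *)
Lemma thetaE u w v : turn u w v -> theta n s (mkedge u w) (mkedge u v) = arc w v.
Proof.
move=> T; have /is_arrowP ar : exists u0 w0 v0,
  [/\ turn u0 w0 v0, mkedge u w = mkedge u0 w0 & mkedge u v = mkedge u0 v0] by exists u, w, v.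
rewrite /theta; set P := fun a : pvert * pvert * nat => _.
set a := nth _ _ _.
have Pa : P a by apply: nth_find.
have /arrowsP[u' [w' [v' [T' def_a]]]] : a \in arrows n s.
  by apply: mem_nth; rewrite -has_find.
move: Pa; rewrite def_a /P /= => /andP[/eqP/mkedge_inj e1 /eqP/mkedge_inj e2].
have [_ _ _ [? ? ?]] := turn_lt T; have [_ _ _ [? ? ?]] := turn_lt T'.
by congr arc; lia.
Qed.

End Triangulation.

(** * Displacement between edges, and the last arrow of a shortest displacement *)

Section Distance.
Variables (n : nat) (s : seq pvert).
Hypotheses (n3 : 3 <= n) (triP : triangulation n s).

Local Notation arc := (carc n).
Local Notation nxt := (cnext n).
Local Notation adj := (adj n s).
Local Notation turn := (turn n s).

Lemma arc_ltn u v : u < n -> v < n -> arc u v < n.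
Proof. geo. Qed.

Lemma arcnn u : arc u u = 0.
Proof. geo. Qed.

Lemma arc_inj o a b : o < n -> a < n -> b < n -> arc o a = arc o b -> a = b.
Proof. geo. Qed.

(** Cutting the circle at [o] turns [arc o] into a linear coordinate, and [arc a b] is the
    difference of coordinates up to one turn. The later estimates are all made in such
    coordinates. *)
Lemma arc_rel o a b : o < n -> a < n -> b < n ->
  (arc o a <= arc o b /\ arc a b + arc o a = arc o b) \/
  (arc o b < arc o a /\ arc a b + arc o a = arc o b + n).
Proof. geo. Qed.

Lemma ccw_rel o a b c : o < n -> a < n -> b < n -> c < n ->
  ccw a b c = ccw (arc o a) (arc o b) (arc o c).
Proof. geo. Qed.

Lemma nxt_rel o a b : o < n -> a < n -> b < n -> b = nxt a ->
  (arc o b = (arc o a).+1) \/ (arc o b = 0 /\ (arc o a).+1 = n).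
Proof. geo. Qed.

Lemma noncrossing_rel o a b c d : o < n -> adj a b -> adj c d ->
  arc o a < arc o c -> arc o c < arc o b -> arc o b < arc o d -> False.
Proof.
move=> o_n ab cd ac cb bd.
have [a_n b_n _] := adj_lt n3 triP ab; have [c_n d_n _] := adj_lt n3 triP cd.
by apply: (adj_noncrossing n3 triP ab cd); rewrite (ccw_rel o_n) //; geo.
Qed.

(* The least total anticlockwise displacement of the two endpoints of [e] that
   carries [e] onto [f]; on the edges of the triangulation it is the minimal
   theta-length. *)
Definition dist (e f : pvert) : nat :=
  minn (arc e.1 f.1 + arc e.2 f.2) (arc e.1 f.2 + arc e.2 f.1).

Lemma distE a b c d :
  dist (mkedge a b) (mkedge c d) = minn (arc a c + arc b d) (arc a d + arc b c).
Proof.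
rewrite /dist /mkedge /=.
by case: (leqP a b) => _; case: (leqP c d) => _; lia.
Qed.

Lemma arc_triangle u v w : u < n -> v < n -> w < n -> arc u w <= arc u v + arc v w.
Proof. geo. Qed.

Lemma dist_triangle e f g : is_edge n s e -> is_edge n s f -> is_edge n s g ->
  dist e g <= dist e f + dist f g.
Proof.
move=> /(is_edge_lt triP) lt_e /(is_edge_lt triP) lt_f /(is_edge_lt triP) lt_g.
have tr u v w := @arc_triangle u v w.
rewrite /dist.
have := tr e.1 f.1 g.1; have := tr e.1 f.2 g.1; have := tr e.2 f.1 g.1; have := tr e.2 f.2 g.1.
have := tr e.1 f.1 g.2; have := tr e.1 f.2 g.2; have := tr e.2 f.1 g.2; have := tr e.2 f.2 g.2.
by lia.
Qed.

Lemma dist_refl e : dist e e = 0.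
Proof. rewrite /dist; geo. Qed.

Lemma dist_mkedge_le u w v : dist (mkedge u w) (mkedge u v) <= arc w v.
Proof. by rewrite distE geq_min {1}/carc leqnn subnn add0n leqnn. Qed.

Definition within (u v x y : nat) : bool := arc u x < arc u y <= arc u v.

(** By non-crossing, [{x, y}] lies on one closed side of the chord [{u, v}]. Naming the ends
    suitably, one walks from [u'] to [v'] and meets [x'] before [y']. *)
Lemma edges_within x y u v : adj x y -> adj u v ->
  exists u' v' x' y', [/\ mkedge u' v' = mkedge u v, mkedge x' y' = mkedge x y & within u' v' x' y'].
Proof.
have wlog_lt x' y' : adj x' y' -> adj u v -> arc u x' < arc u y' ->
    [\/ within u v x' y', within v u x' y' | within v u y' x'].
  move=> xy uv lt_xy.
  have [x_n y_n Nxy] := adj_lt n3 triP xy; have [u_n v_n Nuv] := adj_lt n3 triP uv.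
  have nc := noncrossing_rel u_n uv xy.
  have u0 := arcnn u.
  have Nx := @arc_inj u x' u u_n x_n u_n.
  have Nv := @arc_inj u v u u_n v_n u_n.
  have := arc_rel u_n v_n u_n; have := arc_rel u_n v_n x_n; have := arc_rel u_n v_n y_n.
  have Dy := arc_ltn u_n y_n; have Dv := arc_ltn u_n v_n.
  case: (leqP (arc u y') (arc u v)) => [yv | vy]; first by move=> *; apply: Or31; rewrite /within lt_xy.
  case: (leqP (arc u v) (arc u x')) => [vx | xv] h1 h2 h3.
    by apply: Or32; rewrite /within; lia.
  (* Here [x'] comes before [v] and [y'] after it; not crossing forces [x' = u], and then [y'] is
     met before [x'] on the way from [v] to [u]. *)
  have [x0 | x0] := posnP (arc u x'); last by case: nc; lia.
  by apply: Or33; rewrite /within; lia.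
move=> xy uv; have [x_n y_n Nxy] := adj_lt n3 triP xy; have [u_n v_n Nuv] := adj_lt n3 triP uv.
have Ne := @arc_inj u x y u_n x_n y_n.
have [lt_xy | lt_yx] : arc u x < arc u y \/ arc u y < arc u x by lia.
- have [] := wlog_lt _ _ xy uv lt_xy => in_uv.
  + by exists u, v, x, y.
  + by exists v, u, x, y; rewrite mkedgeC.
  + by exists v, u, y, x; rewrite mkedgeC [mkedge y x]mkedgeC.
- rewrite adjC in xy; have [] := wlog_lt _ _ xy uv lt_yx => in_uv.
  + by exists u, v, y, x; rewrite [mkedge y x]mkedgeC.
  + by exists v, u, y, x; rewrite mkedgeC [mkedge y x]mkedgeC.
  + by exists v, u, x, y; rewrite mkedgeC.
Qed.

Lemma inner_rel u w v : inner n s u w v -> 0 < arc u w < arc u v.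
Proof.
case=> uwv uw wv uv; have [u_n w_n Nuw] := adj_lt n3 triP uw; have [_ v_n Nuv] := adj_lt n3 triP uv.
by move: uwv; geo.
Qed.

(** The triangle [u w v] divides the part of the polygon cut off by [{u, v}]. An edge there other
    than [{u, v}] lies behind [{u, w}] or behind [{w, v}], since it crosses neither. *)
Lemma within_split u w v x y : adj x y -> inner n s u w v -> within u v x y ->
  [\/ x = u /\ y = v, within u w x y | within w v x y].
Proof.
move=> xy I /andP[lt_xy le_yv]; have lt_w := inner_rel I.
case: I => [_ uw wv uv].
have [x_n y_n Nxy] := adj_lt n3 triP xy; have [u_n v_n Nuv] := adj_lt n3 triP uv.
have [_ w_n _] := adj_lt n3 triP uw.
have nc1 := noncrossing_rel u_n uw xy; have nc2 := noncrossing_rel u_n xy wv.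
have u0 := arcnn u.
have Nx := @arc_inj u x u u_n x_n u_n; have Ny := @arc_inj u y v u_n y_n v_n.
case: (leqP (arc u y) (arc u w)) => yw; first by apply: Or32; rewrite /within lt_xy.
case: (leqP (arc u w) (arc u x)) => wx.
  apply: Or33; have := arc_rel u_n w_n x_n; have := arc_rel u_n w_n y_n.
  by have := arc_rel u_n w_n v_n; rewrite /within; lia.
have [x0 | x0] := posnP (arc u x); last by case: nc1; lia.
apply: Or31; split; first by apply: Nx; lia.
by apply: Ny; case: (ltnP (arc u y) (arc u v)) => // lt_yv; [case: nc2; lia | lia].
Qed.

Lemma within_side u x y : u < n -> x < n -> y < n -> within u (nxt u) x y -> x = u /\ y = nxt u.
Proof. by move=> u_n x_n y_n; rewrite /within; geo. Qed.

(** An edge strictly behind [{w, v}] prevents [{w, v}] from being a side along that arc. This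
    supplies the diagonal at [v] on which the existence of an external arrow depends. *)
Lemma within_nonside w v x y : w < n -> v < n -> x < n -> y < n ->
  within w v x y -> ~ (x = w /\ y = v) -> v <> nxt w /\ (w <> nxt v -> adj w v -> has_diag s v).
Proof.
move=> w_n v_n x_n y_n in_wv Nwv; have Nside : v <> nxt w.
  by move=> vE; apply: Nwv; rewrite vE in in_wv *; apply: within_side.
split=> // Nvw /orP[/(sideP n3 w_n v_n)[] // | ds].
by apply/hasP; exists (mkedge w v) => //; rewrite /mkedge /=; lia.
Qed.

Lemma arc_nxt v : v < n -> (arc (nxt v) v).+1 = n.
Proof. geo. Qed.

Lemma arc_le o a b : o < n -> a < n -> b < n -> arc o a <= arc o b ->
  arc a b + arc o a = arc o b.
Proof. by move=> o_n a_n b_n; case: (arc_rel o_n a_n b_n) => [[]|[]]; lia. Qed.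

Lemma arc_gt o a b : o < n -> a < n -> b < n -> arc o b < arc o a ->
  arc a b + arc o a = arc o b + n.
Proof. by move=> o_n a_n b_n; case: (arc_rel o_n a_n b_n) => [[]|[]]; lia. Qed.

(** The arrow into [{u, v}] around [v] is external exactly when [u = nxt v]. The final alternative
    locates its source: measured from [u], [w] lies beyond [v] for an internal arrow and just before
    [v] for the external one. *)
Lemma fan_turn u v : adj u v -> (u = nxt v -> has_diag s v) ->
  exists w, [/\ turn v w u, w < n &
    arc u v < arc u w \/ (u = nxt v /\ (arc u w).+1 = arc u v)].
Proof.
move=> uv hd; have [u_n v_n Nuv] := adj_lt n3 triP uv.
have [uE | Nu] := eqVneq u (nxt v).
  have [pn pE] := prvE n3 v_n; set w := (_ %% n) in pn pE.
  exists w; split=> //; first by right; split=> //; exact: hd.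
  right; split=> //; clearbody w; clear hd; subst; move: pn v_n n3 Nuv; geo.
have [|w I] := fan_inner n3 triP _ (elimN eqP Nu); first by rewrite adjC.
have lt_w := inner_rel I.
have [_ /(adj_lt n3 triP)[_ w_n _] _ _] := I.
exists w; split=> //; first by left.
by left; move: lt_w; geo.
Qed.

(** Arrange that [{x, y}] lies on the arc from [u] to [v], and let [w] be the apex of the triangle
    on that side. If [{x, y}] lies behind [{u, w}] or equals [{w, v}], some optimal displacement
    brings an end to [v] through [w], so the turn around [u] is tight. Otherwise both ends lie
    between [w] and [v], and the turn around [v] into [u] is tight. *)
Lemma tight_turn x y u v : adj x y -> adj u v -> mkedge x y <> mkedge u v ->
  exists u' w' v', [/\ turn u' w' v', mkedge u' v' = mkedge u v &
    dist (mkedge x y) (mkedge u' w') + arc w' v' = dist (mkedge x y) (mkedge u v)].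
Proof.
move=> xy0 uv0 Ne; have [u1 [v1 [x1 [y1 [Euv Exy in_uv]]]]] := edges_within xy0 uv0.
have {xy0} xy : adj x1 y1 by rewrite /adj Exy.
have {uv0} uv : adj u1 v1 by rewrite /adj Euv.
rewrite -Exy -Euv in Ne *; move: u1 v1 x1 y1 xy uv in_uv Ne {Euv Exy u v x y} => u v x y xy uv in_uv Ne.
have [x_n y_n Nxy] := adj_lt n3 triP xy; have [u_n v_n Nuv] := adj_lt n3 triP uv.
have Nv : v <> nxt u.
  by move=> vE; apply: Ne; rewrite vE in in_uv *; case: (within_side u_n x_n y_n in_uv) => -> ->.
have [w I] := fan_inner n3 triP uv Nv.
have [_ uw wv _] := I; have [_ w_n Nuw] := adj_lt n3 triP uw.
have lt_w := inner_rel I; have u0 := arcnn u.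
have v_lt := arc_ltn u_n v_n.
have Hsplit := within_split xy I in_uv.
have w_lt := arc_ltn u_n w_n.
have Ew := arc_le u_n w_n v_n ltac:(lia).
case: Hsplit => [[xu yv] | in_uw | in_wv]; first by case: Ne; rewrite xu yv.
- exists u, w, v; split=> //; first by left.
  move: in_uv in_uw => /andP[lt_xy le_yv] /andP[_ le_yw]; rewrite !distE.
  clear - n3 u_n x_n y_n v_n w_n lt_xy le_yv le_yw lt_w v_lt w_lt Ew u0.
  have Exv := arc_le u_n x_n v_n ltac:(lia).
  have Exw := arc_le u_n x_n w_n ltac:(lia).
  have Eyv := arc_le u_n y_n v_n ltac:(lia).
  have Eyw := arc_le u_n y_n w_n ltac:(lia).
  have Eyu := arc_gt u_n y_n u_n ltac:(lia).
  by case: (arc_rel u_n x_n u_n); lia.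
have [[xw yv] | Nwv] : (x = w /\ y = v) \/ ~ (x = w /\ y = v) by lia.
  exists u, w, v; split=> //; first by left.
  rewrite xw yv !distE !arcnn.
  clear - n3 u_n x_n y_n v_n w_n lt_w v_lt w_lt Ew u0.
  have Ewu := arc_gt u_n w_n u_n ltac:(lia).
  have Evu := arc_gt u_n v_n u_n ltac:(lia).
  by have Evw := arc_gt u_n v_n w_n ltac:(lia); lia.
have [w' [T w'_n pos_w']] : exists w', [/\ turn v w' u, w' < n &
    arc u v < arc u w' \/ (u = nxt v /\ (arc u w').+1 = arc u v)].
  apply: fan_turn => // uE.
  have [_] := within_nonside w_n v_n x_n y_n in_wv Nwv; apply=> //.
  by move=> wE; apply: Nuw; rewrite uE wE.
exists v, w', u; split=> //; first by rewrite mkedgeC.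
have rxw : arc u w <= arc u x.
  move: in_wv => /andP[lt_xy le_yv].
  by case: (arc_rel u_n w_n x_n); case: (arc_rel u_n w_n y_n); lia.
move: in_uv => /andP[lt_xy le_yv].
have lt_w'n := arc_ltn u_n w'_n.
(* In the external case [v] is the last vertex seen from [u]; recording this numerically leaves only
   linear arithmetic. *)
have {}pos_w' : arc u v < arc u w' \/ ((arc u w').+1 = arc u v /\ (arc u v).+1 = n).
  by case: pos_w' => [|[-> H]]; [left | right; rewrite H arc_nxt].
rewrite !distE.
clear -n3 u_n v_n x_n w'_n y_n lt_xy le_yv lt_w'n lt_w rxw v_lt u0 pos_w'.
have Ew'u := arc_gt u_n w'_n u_n ltac:(lia); move: pos_w'.
have Exv := arc_le u_n x_n v_n ltac:(lia).
have Exu := arc_gt u_n x_n u_n ltac:(lia).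
have Eyv := arc_le u_n y_n v_n ltac:(lia).
have Eyu := arc_gt u_n y_n u_n ltac:(lia).
have Ex := arc_rel u_n x_n w'_n; have Ey := arc_rel u_n y_n w'_n.
case=> pos_w'.
  by case: Ex => [[? Ex]|[? Ex]]; [case: Ey => [[? Ey]|[? Ey]] | ]; lia.
by case: Ex => [[? Ex]|[? Ex]]; case: Ey => [[? Ey]|[? Ey]]; lia.
Qed.
End Distance.

(** * Comparing the two arrows into a common target *)

Section Diamond.
Variables (n : nat) (s : seq pvert).
Hypotheses (n3 : 3 <= n) (triP : triangulation n s).

Local Notation arc := (carc n).
Local Notation nxt := (cnext n).
Local Notation adj := (adj n s).
Local Notation turn := (turn n s).
Local Notation inner := (inner n s).
Local Notation dist := (dist n).
Local Notation within := (within n).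

Lemma turn_rel u w v : turn u w v ->
  arc v u < arc v w \/ (v = nxt u /\ (arc v w).+1 = arc v u /\ (arc v u).+1 = n).
Proof.
move=> T; have [u_n w_n v_n [? ? ?]] := turn_lt n3 triP T.
case: T => [I | [_ _ _ uE vE]].
  left; have := inner_rel n3 triP I; geo.
right; split=> //; clear triP; subst; geo.
Qed.

(** The case of [diamond] in which [{x, y}] lies on the same side of [{u, v}] as [w]. The tail
    [{v, w} -> {u, w} -> {u, v}] moves [v] to [u] and then [w] to [v], whence the two arcs of the
    conclusion. With positions measured from [u], each case of [within_split] is linear. *)
Lemma diamond_within u w v w' x y N :
  inner u w v -> turn v w' u -> adj x y -> within u v x y ->
  dist (mkedge x y) (mkedge u w) + arc w v <= N ->
  dist (mkedge x y) (mkedge v w') + arc w' u <= N ->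
  dist (mkedge x y) (mkedge v w) + arc w v + arc v u <= N.
Proof.
move=> I T xy in_uv.
have [_ w'_n _ _] := turn_lt n3 triP T.
have [_ uw wv uv] := I; have [_ w_n Nuw] := adj_lt n3 triP uw.
have [x_n y_n Nxy] := adj_lt n3 triP xy; have [u_n v_n Nuv] := adj_lt n3 triP uv.
have lt_w := inner_rel n3 triP I; have u0 := arcnn n3 u.
have v_lt := arc_ltn n3 u_n v_n; have w'_lt := arc_ltn n3 u_n w'_n.
have Ew := arc_le n3 u_n w_n v_n ltac:(lia).
have Ew' := arc_gt n3 u_n v_n w_n ltac:(lia).
have Ev := arc_gt n3 u_n v_n u_n ltac:(lia).
have pos_w' : arc u v < arc u w' \/ ((arc u w').+1 = arc u v /\ (arc u v).+1 = n).
  by case: (turn_rel T) => [|[_ []]]; [left | right].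
have Ew'u := arc_gt n3 u_n w'_n u_n ltac:(lia).
have Hsplit := within_split n3 triP xy I in_uv.
rewrite !(distE n3).
have w_lt : arc u w < n by lia.
move: in_uv => /andP[lt_xy le_yv].
clear I T xy uw wv uv Nuw Nxy Nuv.
case: Hsplit => [[-> ->] | in_uw | in_wv].
- rewrite !(arcnn n3).
  have Euw := arc_le n3 u_n u_n w_n ltac:(lia).
  have Euv := arc_le n3 u_n u_n v_n ltac:(lia).
  have Euw' := arc_le n3 u_n u_n w'_n ltac:(lia).
  by case: pos_w'; lia.
- move: in_uw => /andP[_ le_yw].
  have Exv := arc_le n3 u_n x_n v_n ltac:(lia).
  have Exw := arc_le n3 u_n x_n w_n ltac:(lia).
  have Eyv := arc_le n3 u_n y_n v_n ltac:(lia).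
  have Eyw := arc_le n3 u_n y_n w_n ltac:(lia).
  have Eyu := arc_gt n3 u_n y_n u_n ltac:(lia).
  have Exw' := arc_le n3 u_n x_n w'_n ltac:(lia).
  have Eyw' := arc_le n3 u_n y_n w'_n ltac:(lia).
  have Exu := arc_rel n3 u_n x_n u_n.
  by case: Exu => [] [? Exu]; case: pos_w'; lia.
- have rxw : arc u w <= arc u x.
    move: in_wv => /andP[lt_xy' le_yv'].
    by case: (arc_rel n3 u_n w_n x_n); case: (arc_rel n3 u_n w_n y_n); lia.
  clear in_wv.
  have Exv := arc_le n3 u_n x_n v_n ltac:(lia).
  have Eyv := arc_le n3 u_n y_n v_n ltac:(lia).
  have Eyu := arc_gt n3 u_n y_n u_n ltac:(lia).
  have Exu := arc_gt n3 u_n x_n u_n ltac:(lia).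
  have Eyw := arc_gt n3 u_n y_n w_n ltac:(lia).
  have Exw := arc_rel n3 u_n x_n w_n; have Exw' := arc_rel n3 u_n x_n w'_n.
  have Eyw' := arc_rel n3 u_n y_n w'_n.
  case: pos_w' => pos_w'; case: Exw' => [] [? Exw']; try (exfalso; lia);
    case: Eyw' => [] [? Eyw']; try (exfalso; lia); case: Exw => [] [? Exw]; lia.
Qed.

(* If paths of length [N] from [{x, y}] to [{u, v}] can end with either of the two
   arrows into [{u, v}], then one of them can end with two sides of a triangle,
   which the potential exchanges for the rest of a big cycle ending with the
   other arrow. *)
Lemma diamond u w v w' x y N :
  turn u w v -> turn v w' u -> adj x y ->
  dist (mkedge x y) (mkedge u w) + arc w v <= N ->
  dist (mkedge x y) (mkedge v w') + arc w' u <= N ->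
  (inner u w v /\ dist (mkedge x y) (mkedge v w) + arc w v + arc v u <= N) \/
  (inner v w' u /\ dist (mkedge x y) (mkedge u w') + arc w' u + arc u v <= N).
Proof.
move=> T1 T2 xy.
have [_ uv] := turn_adj n3 T1; have [u_n v_n Nuv] := adj_lt n3 triP uv.
have [u1 [v1 [x1 [y1 [Euv Exy in_uv]]]]] := edges_within n3 triP xy uv.
have {xy} xy : adj x1 y1 by rewrite /adj Exy.
rewrite -Exy => D1 D2.
have not_both : ~ (outer n s u w v /\ outer n s v w' u).
  case=> [[_ _ _ _ vE] [_ _ _ _ uE]].
  by have := cnext_spec n u; have := cnext_spec n v; rewrite -vE -uE; lia.

case/mkedge_inj: Euv => -[? ?]; subst u1 v1.
- case: T1 => [I1 | O1]; first by left; split=> //; apply: diamond_within T2 _ _ _ _.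
  case: T2 => [I2 | O2]; last by case: not_both.
  (* An external turn around [u] makes [{u, v}] a side with an empty arc, so [{x, y} = {u, v}]. This
     edge may equally be viewed from the other side, where the turn around [v] is internal. *)
  right; split=> //; have [_ _ _ _ vE] := O1.
  have [x_n y_n Nxy] := adj_lt n3 triP xy.
  move: in_uv; rewrite vE => /(within_side n3 u_n x_n y_n); rewrite -vE => -[? ?]; subst x1 y1.
  rewrite mkedgeC in D1 D2 *; apply: (diamond_within (w' := w)) D2 D1 => //; first by right.
    by rewrite adjC.
  rewrite /within (arcnn n3) leqnn andbT lt0n; apply/eqP=> h0.
  by case: Nuv; apply: (@arc_inj n n3 v); rewrite ?h0 ?(arcnn n3).
- case: T2 => [I2 | O2]; first by right; split=> //; apply: diamond_within T1 _ _ _ _.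
  case: T1 => [I1 | O1]; last by case: not_both.
  left; split=> //; have [_ _ _ _ uE] := O2.
  have [x_n y_n Nxy] := adj_lt n3 triP xy.
  move: in_uv; rewrite uE => /(within_side n3 v_n x_n y_n); rewrite -uE => -[? ?]; subst x1 y1.
  rewrite mkedgeC in D1 D2 *; apply: (diamond_within (w' := w')) D1 D2 => //; first by right.
  rewrite /within (arcnn n3) leqnn andbT lt0n; apply/eqP=> h0.
  by case: Nuv; apply: (@arc_inj n n3 u); rewrite ?h0 ?(arcnn n3).
Qed.
End Diamond.

(** * Theta-lengths of paths and cycles, and cyclic derivatives *)

Section Paths.
Variables (n : nat) (s : seq pvert).

Local Notation is_arrow := (is_arrow n s).
Local Notation theta := (theta n s).
Local Notation theta_len := (theta_len n s).
Local Notation valid_path := (valid_path n s).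

Lemma theta_len_cat e xs ys :
  theta_len (e, xs ++ ys) = theta_len (e, xs) + theta_len (last e xs, ys).
Proof. by rewrite /theta_len /= pairmap_cat sumn_cat. Qed.

Lemma theta_len_rcons e xs f :
  theta_len (e, rcons xs f) = theta_len (e, xs) + theta (last e xs) f.
Proof. by rewrite -cats1 theta_len_cat /theta_len /= addn0. Qed.

Lemma valid_rcons e xs f :
  valid_path (e, rcons xs f) = valid_path (e, xs) && is_arrow (last e xs) f.
Proof. by rewrite /valid_path /= rcons_path andbA. Qed.

Lemma valid_pcat p q : valid_path p -> valid_path q -> tgt p = q.1 -> valid_path (pcat p q).
Proof.
by move=> /andP[Ep pp] /andP[_ pq]; rewrite /valid_path /= cat_path Ep pp -/(tgt p) => ->.
Qed.

Lemma theta_len_pcat p q : tgt p = q.1 -> theta_len (pcat p q) = theta_len p + theta_len q.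
Proof. by case: p q => e xs [f ys] /= <-; rewrite /pcat /= theta_len_cat. Qed.

Lemma tgt_pcat p q : tgt p = q.1 -> tgt (pcat p q) = tgt q.
Proof. by case: p q => e xs [f ys] /= <-; rewrite /tgt /= last_cat. Qed.

Definition loop_theta (c : seq pvert) : nat :=
  if c is x :: c' then theta_len (x, rcons c' x) else 0.

Lemma loop_theta_cat c1 c2 : loop_theta (c1 ++ c2) = loop_theta (c2 ++ c1).
Proof.
case: c1 => [|x c1]; first by rewrite cats0.
case: c2 => [|y c2]; first by rewrite cats0.
have loopE x' y' d1 d2 : theta_len (x', rcons (d1 ++ y' :: d2) x') =
    theta_len (x', rcons d1 y') + theta_len (y', rcons d2 x').
  by rewrite -cats1 -catA cat_cons -cat_rcons theta_len_cat last_rcons cats1.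
by rewrite /= !loopE addnC.
Qed.

Lemma loop_theta_rot i c : loop_theta (rot i c) = loop_theta c.
Proof. by rewrite /rot loop_theta_cat cat_take_drop. Qed.

Lemma rot_index_rcons (e : pvert) (c : seq pvert) : e \in c ->
  rot (index e c).+1 c = rcons (drop (index e c).+1 c ++ take (index e c) c) e.
Proof.
move=> e_c; rewrite /rot (take_nth e) ?index_mem // nth_index //.
by rewrite -rcons_cat.
Qed.

(* What remains of the cycle [c] once its arrow starting at [e] is deleted. *)
Definition cut_cycle (e : pvert) (c : seq pvert) : qpath :=
  let d := rot (index e c).+1 c in (head e d, behead d).

Lemma cut_cycleP e c : e \in c -> all (is_edge n s) c -> cycle is_arrow c ->
  let f := (cut_cycle e c).1 in
  [/\ valid_path (cut_cycle e c), tgt (cut_cycle e c) = e, is_arrow e f, f \in c &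
      theta_len (cut_cycle e c) + theta e f = loop_theta c].
Proof.
move=> e_c Ec cyc; rewrite /cut_cycle.
have Ed : {subset rot (index e c).+1 c <= c} by move=> x; rewrite mem_rot.
rewrite -(loop_theta_rot (index e c).+1).
have := cyc; rewrite -(rot_cycle (index e c).+1).
have : last e (rot (index e c).+1 c) = e by rewrite rot_index_rcons // last_rcons.
have : rot (index e c).+1 c <> [::] by rewrite rot_index_rcons //; case: (_ ++ _).
case: (rot _ _) Ed => // f d Ed _ /= last_d.
rewrite rcons_path last_d theta_len_rcons /= last_d => /andP[path_d ef].
have f_c : f \in c by apply: Ed; rewrite mem_head.
by split=> //; rewrite /valid_path /= path_d (allP Ec).
Qed.

(** Whether [e -> f] is an arrow of the cycle [c]: the cut cycle begins where the deleted arrow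
    ended. *)
Definition follows (e f : pvert) (c : seq pvert) : bool := (e \in c) && ((cut_cycle e c).1 == f).

(** A cycle without repeated vertices contains an arrow at most once, so its cyclic derivative has
    at most one term. *)
Lemma cyc_deriv_uniq (K : fieldType) e f b c : uniq c ->
  cyc_deriv K e f (b, c) =
  if follows e f c then [:: ((if b then 1%R else (-1)%R), cut_cycle e c)] else [::].
Proof.
move=> Uc; rewrite /cyc_deriv /follows /=.
have nthS i : i < size c -> nth e c (i.+1 %% size c) = head e (rot i.+1 c).
  move=> lt_i; rewrite -nth0 /rot nth_cat size_drop subn_gt0.
  case: ltnP => [lt_i1 | le_c]; first by rewrite modn_small // nth_drop addn0.
  (* At the last index the successor wraps around to the first entry, and the full rotation is [c]
     itself. *)
  have -> : i.+1 = size c by apply/eqP; rewrite eqn_leq lt_i.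
  by rewrite modnn subnn take_size.
have eqP_ i : i \in iota 0 (size c) -> (nth e c i == e) && (nth e c (i.+1 %% size c) == f)
  = (follows e f c && (i == index e c)).
  rewrite mem_iota /= add0n => lt_i; rewrite nthS //.
  have [e_i | Ne] := eqVneq (nth e c i) e; last first.
    case: (eqVneq i (index e c)) Ne => [-> | _ _]; last by rewrite andbF.
    by rewrite andbT /follows -index_mem; case: ltnP => // h; rewrite nth_index ?eqxx // -index_mem.
  have e_c : e \in c by rewrite -e_i mem_nth.
  have -> : i = index e c by rewrite -e_i index_uniq.
  by rewrite eqxx andbT /follows e_c.
rewrite (eq_in_filter eqP_) -/(follows e f c).
case: (boolP (follows e f c)) => [/andP[e_c _] | _]; last by rewrite filter_pred0.
rewrite /= filter_pred1_uniq ?iota_uniq ?mem_iota ?index_mem //=.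
Qed.
End Paths.

(** * The cycles of the potential: triangles and big cycles *)

Section Cycles.
Variables (n : nat) (s : seq pvert).
Hypotheses (n3 : 3 <= n) (triP : triangulation n s).

Local Notation arc := (carc n).
Local Notation turn := (turn n s).
Local Notation inner := (inner n s).
Local Notation is_arrow := (is_arrow n s).
Local Notation theta := (theta n s).
Local Notation loop_theta := (loop_theta n s).

(** An external turn would make [w] the last vertex seen from [u], although [v] comes later. Two
    internal turns with different targets would give crossing edges. *)
Lemma inner_turn_next u w v z : inner u w v -> turn u w z -> z = v.
Proof.
move=> I T; have [uwv uw wv uv] := I; have [u_n w_n z_n [? ? ?]] := turn_lt n3 triP T.
have [_ v_n Nuv] := adj_lt n3 triP uv.
have lt_w := inner_rel n3 triP I; have v_lt := arc_ltn n3 u_n v_n.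
case: T => [J | [_ _ _ uE _]]; last first.
  have := arc_nxt n3 w_n; rewrite -uE => w_last.
  by have := leq_trans v_lt (eq_leq (esym w_last)); rewrite ltnS leqNgt; case/andP: lt_w => _ ->.
have [_ _ wz uz] := J; have /andP[w0 lt_z] := inner_rel n3 triP J; case/andP: lt_w => _ lt_w.
apply: (arc_inj n3 u_n z_n v_n); case: (ltngtP (arc u z) (arc u v)) => // lt_vz.
- by case: (noncrossing_rel n3 triP u_n uz wv); rewrite ?(arcnn n3).
- by case: (noncrossing_rel n3 triP u_n uv wz); rewrite ?(arcnn n3).
Qed.

Lemma tri_cycleP t : t \in triangles n s ->
  [/\ uniq (tri_cycle t), all (is_edge n s) (tri_cycle t), cycle is_arrow (tri_cycle t) &
      loop_theta (tri_cycle t) = n].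
Proof.
move=> t_tri; have := t_tri; case: t t_tri => -[p q] r t_tri.
rewrite mem_filter => /andP[/and5P[pq qr Epq Eqr Epr] _].
have ar a : a \in tri_arrows n (p, q, r) -> is_arrow a.1.1 a.1.2.
  move=> /(tri_arrows_inner n3 triP t_tri)[u [w [v [I ->]]]].
  by apply/(is_arrowP n3 triP); exists u, w, v; split=> //; left.
have th a : a \in tri_arrows n (p, q, r) -> theta a.1.1 a.1.2 = a.2.
  move=> /(tri_arrows_inner n3 triP t_tri)[u [w [v [I ->]]]].
  by rewrite /= thetaE //; left.
have [m1 m2 m3] : [/\ (p, q, (p, r), r - q) \in tri_arrows n (p, q, r),
  (p, r, (q, r), q - p) \in tri_arrows n (p, q, r) & (q, r, (p, q), n - r + p) \in tri_arrows n (p, q, r)].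
  by rewrite !inE !eqxx ?orbT.
have r_n : r < n by case/andP: (is_edge_lt triP Epr).
split.
- by rewrite /= !inE !xpair_eqE; lia.
- by rewrite /= Epq Eqr Epr.
- by rewrite /= (ar _ m1) (ar _ m2) (ar _ m3).
- by rewrite /= /theta_len /= (th _ m1) (th _ m2) (th _ m3) /=; lia.
Qed.

Lemma tri_arrows_follows t e f k : t \in triangles n s -> (e, f, k) \in tri_arrows n t ->
  follows e f (tri_cycle t) /\ f \in tri_cycle t.
Proof.
case: t => -[p q] r; rewrite mem_filter !inE => /andP[/and5P[pq qr _ _ _] _] h.
have [N1 N2 N3] : [/\ ((p, q) == (p, r)) = false, ((p, q) == (q, r)) = false & ((p, r) == (q, r)) = false].
  by rewrite !xpair_eqE; split; lia.
by case/or3P: h => /eqP[-> -> _]; rewrite /follows /cut_cycle /= !inE ?eqxx ?orbT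
  ?[(p, r) == (p, q)]eq_sym ?N1 ?N2 ?N3 //= ?eqxx.
Qed.

(** Two edges with a common vertex already determine the three vertices of a triangle, hence its
    sorted triple. *)
Lemma tri_cycle_follows u w v : inner u w v -> exists2 t, t \in triangles n s &
  forall t', t' \in triangles n s -> follows (mkedge u w) (mkedge u v) (tri_cycle t') = (t' == t).
Proof.
move=> I; have [t t_tri at_t] := inner_triangles n3 triP I.
exists t => // t' t'_tri; apply/idP/eqP => [fol | ->].
  have [_ Ec' cyc' _] := tri_cycleP t'_tri.
  have /andP[e_c /eqP f_c'] := fol.
  have [_ _ _ f_c _] := cut_cycleP e_c Ec' cyc'; rewrite f_c' in f_c.
  have [uwv _ _ _] := I.
  have [_ _ _ [Nuw Nuv Nwv]] := turn_lt n3 triP (or_introl I : turn u w v).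
  have [_ _ _ [? ? ?]] := turn_lt n3 triP (or_introl I : turn u w v).
  have eq_tri t1 : t1 \in triangles n s -> mkedge u w \in tri_cycle t1 -> mkedge u v \in tri_cycle t1 ->
     t1 = if u < w < v then (u, w, v) else if w < v < u then (w, v, u) else (v, u, w).
    case: t1 => -[p q] r; rewrite mem_filter => /andP[/and5P[pq qr _ _ _] _].
    rewrite !inE /mkedge !xpair_eqE => h1 h2; move: uwv; rewrite /ccw => uwv.
    have H : [/\ u < w < v -> p = u /\ q = w /\ r = v, w < v < u -> p = w /\ q = v /\ r = u & v < u < w -> p = v /\ q = u /\ r = w].
      by split; lia.
    case: H => H1 H2 H3.
    case: ifP => [/H1[-> [-> ->]] // | h3]; case: ifP => [/H2[-> [-> ->]] // | h4].
    by rewrite h3 h4 /= in uwv; case: (H3 uwv) => [-> [-> ->]].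
  have [/andP[e_t _] f_t] := tri_arrows_follows t_tri at_t.
  by rewrite (eq_tri t') // (eq_tri t).
by have [] := tri_arrows_follows t_tri at_t.
Qed.
End Cycles.

(** Consecutive entries of a filtered interval have no selected index between them. For the edges at
    a polygon vertex this is the emptiness condition of [fan_triangle]. *)
Lemma filter_iota_path (a : pred nat) (i0 m k : nat) :
  let R i j := [&& i < j, a j & all (predC a) (iota i.+1 (j - i).-1)] in
  i0 < m -> all (predC a) (iota i0.+1 (m - i0).-1) -> path R i0 (filter a (iota m k)).
Proof.
move=> R; elim: k i0 m => [|k IHk] i0 m //= lt_m none.
case: ifP => a_m /=; last first.
  apply: IHk; first exact: ltnW.
  have -> : (m.+1 - i0).-1 = (m - i0).-1 + 1 by lia.
  rewrite iotaD all_cat none /= andbT.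
  by have -> : i0.+1 + (m - i0).-1 = m; rewrite ?a_m //; lia.
by rewrite {1}/R lt_m a_m none /=; apply: IHk => //; rewrite subSnn.
Qed.

Section BigCycle.
Variables (n : nat) (s : seq pvert).
Hypotheses (n3 : 3 <= n) (triP : triangulation n s).

Local Notation arc := (carc n).
Local Notation adj := (adj n s).
Local Notation turn := (turn n s).
Local Notation inner := (inner n s).
Local Notation is_arrow := (is_arrow n s).
Local Notation theta := (theta n s).
Local Notation theta_len := (theta_len n s).
Local Notation loop_theta := (loop_theta n s).

Lemma turn_of_arrow u w v : is_arrow (mkedge u w) (mkedge u v) -> turn u w v.
Proof.
move=> /(is_arrowP n3 triP)[u0 [w0 [v0 [T /mkedge_inj Ew /mkedge_inj Ev]]]].
have [_ _ _ [? ? ?]] := turn_lt n3 triP T.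
by have [-> -> ->] : [/\ u = u0, w = w0 & v = v0] by split; lia.
Qed.

Local Notation pt u i := ((u + i) %% n).

Lemma arc_pt u i : u < n -> i < n -> arc u (pt u i) = i.
Proof.
move=> u_n i_n; rewrite /carc; have [lt_n | le_n] := ltnP (u + i) n.
  by rewrite modn_small // leq_addr addKn.
have -> : pt u i = u + i - n.
  by rewrite -{1}(subnK le_n) modnDr modn_small //; lia.
by case: leqP; lia.
Qed.

Lemma pt_arc u v : u < n -> v < n -> pt u (arc u v) = v.
Proof.
move=> u_n v_n; have m_n : pt u (arc u v) < n by rewrite ltn_mod; lia.
by apply: (arc_inj n3 u_n m_n v_n); rewrite arc_pt // arc_ltn.
Qed.

Section Vertex.
Variable u : nat.
Hypotheses (u_n : u < n) (hd : has_diag s u).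

Let a := [pred i | adj u (pt u i)].
Let g i := mkedge u (pt u i).

Lemma big_cycle_map : big_cycle n s u = map g (filter a (iota 1 n.-1)).
Proof. by rewrite /big_cycle filter_map. Qed.

Lemma mem_big_cycle v : v < n -> v <> u -> (mkedge u v \in big_cycle n s u) = adj u v.
Proof.
move=> v_n Nv; rewrite /big_cycle mem_filter -/(adj u v); apply: andb_idr => _.
apply/mapP; exists (arc u v); last by rewrite pt_arc.
rewrite mem_iota; have := arc_ltn n3 u_n v_n.
have : arc u v <> 0 by move=> h; apply: Nv; apply: (arc_inj n3 u_n v_n u_n); rewrite h (arcnn n3).
by lia.
Qed.

Lemma big_cycle_inv e : e \in big_cycle n s u -> exists2 v, adj u v & e = mkedge u v.
Proof.
rewrite big_cycle_map => /mapP[i]; rewrite mem_filter => /andP[a_i _] ->.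
by exists (pt u i).
Qed.

Lemma fan_step i j : 0 < i < n -> 0 < j < n -> a i -> a j -> i < j ->
  all (predC a) (iota i.+1 (j - i).-1) -> inner u (pt u i) (pt u j).
Proof.
move=> i_n j_n a_i a_j lt_ij none.
have [_ pi_n _] := adj_lt n3 triP a_i; have [_ pj_n _] := adj_lt n3 triP a_j.
have Ei := arc_pt u_n (proj2 (andP i_n)); have Ej := arc_pt u_n (proj2 (andP j_n)).
have uij : ccw u (pt u i) (pt u j).
  by rewrite (ccw_rel n3 u_n) // (arcnn n3) Ei Ej /ccw; lia.
split=> //; apply: (fan_triangle n3 triP a_i a_j) => // x ux.
have [_ x_n Nx] := adj_lt n3 triP ux; apply/negP.
rewrite (ccw_rel n3 u_n) // Ei Ej => ixj.
move/allP/(_ (arc u x)): none; rewrite mem_iota /= pt_arc // ux => none.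
by have /none : i < arc u x < i.+1 + (j - i).-1 by move: ixj; rewrite /ccw; lia.
Qed.

Lemma big_cycleP :
  [/\ uniq (big_cycle n s u), all (is_edge n s) (big_cycle n s u),
      cycle is_arrow (big_cycle n s u) & loop_theta (big_cycle n s u) = n].
Proof.
have a1 : a 1 by rewrite /= addn1 cnextE // adj_nxt.
have an : a n.-1.
  by have [pn pE] := prvE n3 u_n; rewrite /= adjC -{2}pE adj_nxt.
have [l El] : exists l, filter a (iota 2 n.-2) = rcons l n.-1.
  exists (filter a (iota 2 (n - 3))).
  have -> : iota 2 n.-2 = rcons (iota 2 (n - 3)) n.-1.
    have -> : n.-2 = (n - 3) + 1 by lia.
    by rewrite iotaD cats1; congr rcons; lia.
  by rewrite filter_rcons an.
(* Both sides at [u] are edges, so the list of neighbours starts at offset 1 and ends at offset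
   [n - 1]. The external arrow closes it up. *)
have E1 : filter a (iota 1 n.-1) = 1 :: rcons l n.-1.
  have -> : iota 1 n.-1 = [:: 1] ++ iota 2 n.-2 by have -> : n.-1 = n.-2.+1 by lia.
  by rewrite filter_cat El; move: a1 => /= ->.
pose P := [pred i | a i && (0 < i < n)].
have P_fil i : i \in filter a (iota 1 n.-1) -> P i.
  by rewrite mem_filter mem_iota /= => /andP[->]; lia.
have step : {in P &, forall i j, [&& i < j, a j & all (predC a) (iota i.+1 (j - i).-1)] ->
    is_arrow (g i) (g j) && ((i < j) && (theta (g i) (g j) == j - i))}.
  move=> i j /andP[a_i i_n] /andP[a_j j_n] /and3P[lt_ij _ none].
  have T : turn u (pt u i) (pt u j) by left; apply: fan_step none.
  rewrite /g lt_ij thetaE //=; apply/andP; split; first by apply/(is_arrowP n3 triP); exists u, (pt u i), (pt u j).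
  have [_ pi_n pj_n _] := turn_lt n3 triP T.
  by have := arc_le n3 u_n pi_n pj_n; rewrite !arc_pt; lia.
have pathg : path (fun i j => is_arrow (g i) (g j) && ((i < j) && (theta (g i) (g j) == j - i)))
    1 (rcons l n.-1).
  apply: (sub_in_path step); first by apply/allP=> i; rewrite -E1; apply: P_fil.
  by rewrite -El; apply: filter_iota_path; rewrite // subSnn.
have T1 : turn u (pt u n.-1) (pt u 1).
  have [pn pE] := prvE n3 u_n.
  by right; split=> //; rewrite addn1 cnextE.
rewrite big_cycle_map E1; split.
- rewrite map_inj_in_uniq -E1 ?filter_uniq ?iota_uniq // => i j /P_fil/andP[_ i_n] /P_fil/andP[_ j_n].
  move/mkedge_inj_l => Eij; rewrite -(arc_pt u_n (proj2 (andP i_n))) Eij arc_pt //.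
  by case/andP: j_n.
- by apply/allP=> e /mapP[i]; rewrite -E1 => /P_fil/andP[a_i _] ->.
- rewrite [map _ _]/= (cycle_path (g 0)) /= last_map last_rcons path_map.
  apply/andP; split; first by apply/(is_arrowP n3 triP); exists u, (pt u n.-1), (pt u 1).
  by apply: sub_path pathg => i j /andP[].
(* The internal arrows telescope from offset 1 to offset [n - 1], giving [n - 2]; the external arrow
   adds 2. *)
- have tele i0 r : path (fun i j => is_arrow (g i) (g j) && ((i < j) && (theta (g i) (g j) == j - i))) i0 r ->
     theta_len (g i0, map g r) + i0 = last i0 r.
    elim: r i0 => [|i r IHr] i0; first by rewrite /theta_len /= add0n.
    rewrite [path _ _ _]/= => /andP[/and3P[_ lt_i /eqP th]] /IHr /= <-; rewrite /theta_len /= th.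
    by move: (sumn _) => k; lia.
  have := tele _ _ pathg; rewrite last_rcons.
  rewrite /loop_theta /= theta_len_rcons last_map last_rcons thetaE //.
  have [_ pn_n p1_n _] := turn_lt n3 triP T1.
  have := arc_gt n3 u_n pn_n p1_n; rewrite !arc_pt //; try lia.
Qed.
End Vertex.

(** The edges [{u, w}] and [{u, v}] share only [u], so no other big cycle contains both. In the one
    around [u], the successor of [{u, w}] is given by [inner_turn_next]. *)
Lemma big_cycle_follows u w v u' : inner u w v -> has_diag s u -> u' < n -> has_diag s u' ->
  follows (mkedge u w) (mkedge u v) (big_cycle n s u') = (u' == u).
Proof.
move=> I hd u'_n hd'; have [_ uw wv uv] := I.
have [u_n w_n v_n [Nuw Nuv Nwv]] := turn_lt n3 triP (or_introl I : turn u w v).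
apply/idP/eqP => [fol | ->].
  have /andP[e_c /eqP f_c'] := fol.
  have [_ Ec' cyc' _] := big_cycleP u'_n hd'.
  have [_ _ _ f_c _] := cut_cycleP e_c Ec' cyc'; rewrite f_c' in f_c.
  have [x _ /mkedge_inj Ex] := big_cycle_inv e_c.
  have [y _ /mkedge_inj Ey] := big_cycle_inv f_c.
  by lia.
have e_c : mkedge u w \in big_cycle n s u by rewrite mem_big_cycle //; apply/eqP; rewrite eq_sym; apply/eqP.
have [_ Ec cyc _] := big_cycleP u_n hd.
have [_ _ ar f_c _] := cut_cycleP e_c Ec cyc.
have [y _ Ey] := big_cycle_inv f_c; rewrite Ey in ar.
by rewrite /follows e_c Ey (inner_turn_next n3 triP I (turn_of_arrow ar)) /=.
Qed.
End BigCycle.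

(** * Which theta-lengths occur between two edges *)

Section MinimalPaths.
Variables (n : nat) (s : seq pvert).
Hypotheses (n3 : 3 <= n) (triP : triangulation n s).

Local Notation arc := (carc n).
Local Notation turn := (turn n s).
Local Notation is_arrow := (is_arrow n s).
Local Notation is_edge := (is_edge n s).
Local Notation theta := (theta n s).
Local Notation theta_len := (theta_len n s).
Local Notation valid_path := (valid_path n s).
Local Notation dist := (dist n).

Lemma turn_arrow u w v : turn u w v -> is_arrow (mkedge u w) (mkedge u v).
Proof. by move=> T; apply/(is_arrowP n3 triP); exists u, w, v. Qed.

Lemma arrow_edge e f : is_arrow e f -> is_edge e /\ is_edge f.
Proof. by move=> /(is_arrowP n3 triP)[u [w [v [T -> ->]]]]; apply: (turn_adj n3 T). Qed.

Lemma arc_mod u v : u < n -> v < n -> arc u v + u = v %[mod n].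
Proof.
move=> u_n v_n; case: (carc_spec n u v) => [] [? ->]; first by rewrite subnK.
by rewrite subnK ?modnDr //; lia.
Qed.

Lemma arc_gt0 u v : u < n -> v < n -> u <> v -> 0 < arc u v.
Proof.
move=> u_n v_n Nuv; rewrite lt0n; apply/eqP=> h.
by apply: Nuv; apply: (arc_inj n3 u_n u_n v_n); rewrite (arcnn n3).
Qed.

Lemma theta_gt0 e f : is_arrow e f -> 0 < theta e f.
Proof.
move=> /(is_arrowP n3 triP)[u [w [v [T -> ->]]]]; rewrite (thetaE n3 triP T).
by have [_ w_n v_n [_ _ Nwv]] := turn_lt n3 triP T; apply: arc_gt0.
Qed.

Lemma dist_arrow e f : is_arrow e f -> dist e f <= theta e f.
Proof.
move=> /(is_arrowP n3 triP)[u [w [v [T -> ->]]]]; rewrite (thetaE n3 triP T).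
exact: dist_mkedge_le.
Qed.

Lemma valid_src p : valid_path p -> is_edge p.1.
Proof. by case/andP. Qed.

Lemma valid_tgt p : valid_path p -> is_edge (tgt p).
Proof.
case: p => e xs; elim/last_ind: xs => [|xs f _]; first by case/andP.
by rewrite valid_rcons => /andP[_ /arrow_edge[_]]; rewrite /tgt /= last_rcons.
Qed.

Lemma theta_len_ge p : valid_path p -> dist p.1 (tgt p) <= theta_len p.
Proof.
case: p => e xs; elim/last_ind: xs => [|xs f IHxs]; first by rewrite dist_refl.
rewrite valid_rcons => /andP[vp af]; rewrite theta_len_rcons /tgt /= last_rcons.
have [Ef Ef'] := arrow_edge af.
apply: leq_trans (dist_triangle n3 triP (valid_src vp) Ef Ef') _.
by apply: leq_add (IHxs vp) _; apply: dist_arrow.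
Qed.

(** A grading modulo [n]: an arrow raises the sum of the two endpoints by its theta-length, so the
    ends of a path fix its length modulo [n]. *)
Definition weight (e : pvert) : nat := e.1 + e.2.

Lemma weight_mkedge u v : weight (mkedge u v) = u + v.
Proof. by rewrite /weight /mkedge /=; lia. Qed.

Lemma theta_len_weight p : valid_path p -> theta_len p + weight p.1 = weight (tgt p) %[mod n].
Proof.
case: p => e xs; elim/last_ind: xs => [|xs f IHxs] //.
rewrite valid_rcons => /andP[vp af]; rewrite theta_len_rcons /tgt /= last_rcons.
have [u [w [v [T El Ef]]]] := (is_arrowP n3 triP _ _).1 af.
rewrite addnAC -modnDml (IHxs vp) /tgt /= El Ef modnDml (thetaE n3 triP T) !weight_mkedge.
have [u_n w_n v_n _] := turn_lt n3 triP T.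
by rewrite -addnA [w + _]addnC -modnDmr (arc_mod w_n v_n) modnDmr.
Qed.

Lemma dist_weight e f : is_edge e -> is_edge f -> dist e f + weight e = weight f %[mod n].
Proof.
move=> /(is_edge_lt triP)/andP[lt_e lt_e'] /(is_edge_lt triP)/andP[lt_f lt_f'].
have m a b c d : a < n -> b < n -> c < n -> d < n ->
    (arc a c + arc b d) + (a + b) = c + d %[mod n].
  by move=> *; rewrite addnACA -modnDm !arc_mod // modnDm.
rewrite /dist /weight; case: (leqP (arc e.1 f.1 + arc e.2 f.2)) => _; first by rewrite m //; lia.
by rewrite m ?[f.2 + _]addnC //; lia.
Qed.

Lemma theta_len_dist p : valid_path p -> theta_len p = dist p.1 (tgt p) %[mod n].
Proof.
move=> vp; apply/eqP; rewrite -(eqn_modDr (weight p.1)) theta_len_weight //.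
by rewrite dist_weight ?valid_src ?valid_tgt.
Qed.

Definition connects (e f : pvert) (N : nat) (p : qpath) : Prop :=
  [/\ valid_path p, p.1 = e, tgt p = f & theta_len p = N].

(** The path is built from its end: [tight_turn] yields a last arrow whose source is closer to [e]
    by exactly its theta-length. *)
Lemma dist_path e f : is_edge e -> is_edge f -> exists p, connects e f (dist e f) p.
Proof.
move=> Ee Ef; have [m le_m] := ubnP (dist e f); elim: m => // m IHm in f Ef le_m *.
have [-> | Nef] := eqVneq e f.
  by exists (f, [::]); split; rewrite // ?(dist_refl n3) // /valid_path /= Ef.
have [x [y Ee']] := is_edgeE triP Ee; have [u [v Ef']] := is_edgeE triP Ef.
subst e f.
have [u' [w' [v' [T Euv Ed]]]] := tight_turn n3 triP Ee Ef (elimN eqP Nef).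
have ar := turn_arrow T; have [Ew _] := arrow_edge ar.
have pos := theta_gt0 ar; rewrite (thetaE n3 triP T) in pos.
have [|[p1 xs] [vp /= p1E tp th]] := IHm _ Ew; first by rewrite -Ed in le_m; lia.
exists (p1, rcons xs (mkedge u v)); rewrite /tgt /= in tp.
split; rewrite //= ?valid_rcons ?vp ?tp ?theta_len_rcons -?Euv //.
  by rewrite /tgt /= last_rcons.
by rewrite tp th (thetaE n3 triP T) Ed Euv.
Qed.

Lemma connects_pcat e f g M N p q :
  connects e f M p -> connects f g N q -> connects e g (M + N) (pcat p q).
Proof.
move=> [vp ep fp <-] [vq fq gq <-]; have pq : tgt p = q.1 by rewrite fp.
by split=> //; rewrite ?valid_pcat ?tgt_pcat ?theta_len_pcat.
Qed.

Lemma loop_path e : is_edge e -> exists p, connects e e n p.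
Proof.
move=> Ee; have [u [w [v [-> I]]]] := edge_inner n3 triP Ee.
(* Rotating the triangle twice gives the arrow [{v, u} -> {v, w}], which starts at the given
   edge. *)
have [t t_tri fol] := tri_cycle_follows n3 triP (inner_rot n3 (inner_rot n3 I)).
have := fol t t_tri; rewrite eqxx => /andP[e_c /eqP f_c].
have [Uc Ec cyc lt] := tri_cycleP n3 triP t_tri.
have [vp tp ar _ th] := cut_cycleP e_c Ec cyc; rewrite mkedgeC in e_c vp tp ar th.
set p := cut_cycle _ _ in vp tp ar th; rewrite lt in th.
exists (pcat (mkedge u v, [:: p.1]) p); rewrite -th addnC.
apply: (@connects_pcat _ p.1) => //.
split=> //; rewrite /valid_path /= ?ar ?andbT; first by case: (arrow_edge ar).
by rewrite /theta_len /= addn0.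
Qed.

Lemma exists_path e f N : is_edge e -> is_edge f -> dist e f <= N -> N = dist e f %[mod n] ->
  exists p, connects e f N p.
Proof.
move=> Ee Ef le_N /eqP; rewrite eqn_mod_dvd // => /dvdnP[k NE].
have -> : N = k * n + dist e f by lia.
(* The excess over [dist e f] is a multiple of [n], filled by loops around a triangle at [e]. *)
have [q cq] := loop_path Ee; elim: k {NE} => [|k [p cp]]; first exact: dist_path.
by exists (pcat q p); rewrite mulSn -addnA; apply: connects_pcat cp.
Qed.
End MinimalPaths.

(** * The relations given by the cyclic derivatives of the potential *)

Lemma flatten_single (T : eqType) (U : Type) (F : T -> seq U) (l : seq T) x z :
  uniq l -> x \in l -> {in l, forall y, F y = if y == x then [:: z] else [::]} ->
  flatten (map F l) = [:: z].
Proof.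
elim: l => //= y l IHl /andP[Ny Ul]; rewrite inE => /predU1P[-> | x_l] F1.
  rewrite F1 ?mem_head // eqxx (_ : flatten _ = [::]) //.
  elim: l Ny F1 {IHl Ul} => //= t l IHl; rewrite inE negb_or => /andP[Nt Nl] F1.
  rewrite F1 ?inE ?eqxx ?orbT // eq_sym (negPf Nt) IHl // => t' t'_l.
  by apply: F1; move: t'_l; rewrite !inE => /orP[->|->]; rewrite ?orbT.
rewrite F1 ?mem_head // IHl // => [|t t_l]; last by apply: F1; rewrite inE t_l orbT.
by case: eqP Ny => // ->; rewrite x_l.
Qed.

Section Relations.
Variables (K : fieldType) (n : nat) (s : seq pvert).
Hypotheses (n3 : 3 <= n) (triP : triangulation n s).

Local Notation arc := (carc n).
Local Notation nxt := (cnext n).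
Local Notation adj := (adj n s).
Local Notation turn := (turn n s).
Local Notation inner := (inner n s).
Local Notation is_edge := (is_edge n s).

(** Hence an edge has at most two incoming arrows, one around each of its ends. *)
Lemma turn_inj u w w' v : turn u w v -> turn u w' v -> w = w'.
Proof.
move=> T T'; have [u_n w_n v_n _] := turn_lt n3 triP T; have [_ w'_n _ _] := turn_lt n3 triP T'.
have inner_nxt x : inner u x v -> v <> nxt u.
  move=> /(inner_rel n3 triP) lt_x vE.
  by case: (nxt_rel n3 u_n u_n v_n vE) lt_x; rewrite (arcnn n3); lia.
case: T => [I | [_ _ _ uE vE]]; case: T' => [I' | [_ _ _ uE' vE']].
- have [_ uw wv _] := I; have [_ uw' w'v _] := I'.
  have /andP[w0 lt_w] := inner_rel n3 triP I; have /andP[w'0 lt_w'] := inner_rel n3 triP I'.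
  apply: (arc_inj n3 u_n w_n w'_n); case: (ltngtP (arc u w) (arc u w')) => // lt_ww'.
  + by case: (noncrossing_rel n3 triP u_n uw' wv); rewrite ?(arcnn n3).
  + by case: (noncrossing_rel n3 triP u_n uw w'v); rewrite ?(arcnn n3).
- by case: (inner_nxt _ I).
- by case: (inner_nxt _ I').
- by apply: (@cnext_inj n); rewrite // -uE.
Qed.

Lemma inner_has_diag u w v : inner u w v ->
  ~~ (is_side n (mkedge u w) && is_side n (mkedge u v)) -> has_diag s u.
Proof.
move=> [_ uw _ uv]; rewrite negb_and.
have diag x : adj u x -> ~~ is_side n (mkedge u x) -> has_diag s u.
  case/orP=> [-> // | ds _]; apply/hasP; exists (mkedge u x) => //.
  by rewrite /mkedge /=; lia.
by case/orP; apply: diag.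
Qed.

(** At the tip of an ear [w = nxt u] and [u = nxt v], so any diagonal at [u] would cross [{w, v}].
    Thus there is no external arrow there, and no internal one can end at the first edge
    [{u, w}]. *)
Lemma ear_no_turn u w v w' : inner u w v ->
  is_side n (mkedge u w) && is_side n (mkedge u v) -> ~ turn u w' w.
Proof.
move=> I /andP[/sideP s_uw /sideP s_uv] T.
have [uwv uw wv uv] := I; have /andP[w0 lt_w] := inner_rel n3 triP I.
have [u_n w_n _] := adj_lt n3 triP uw; have [_ v_n _] := adj_lt n3 triP uv.
have u0 := arcnn n3 u; have v_lt := arc_ltn n3 u_n v_n.
have wE : w = nxt u.
  case: (s_uw n3 u_n w_n) => // uE.
  by have := arc_nxt n3 w_n; rewrite -uE; lia.
have vE : u = nxt v.
  case: (s_uv n3 u_n v_n) => // uE.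
  by have := nxt_rel n3 u_n u_n v_n uE; rewrite u0; lia.
have w1 : arc u w = 1 by case: (nxt_rel n3 u_n u_n w_n wE); rewrite u0; lia.
have vl : (arc u v).+1 = n by rewrite {1}vE arc_nxt.
case: T => [J | [hd _ _ _ _]]; first by have := inner_rel n3 triP J; lia.
have [x ux xs] : exists2 x, adj u x & mkedge u x \in s.
  have [d d_s Ed] := hasP hd.
  have Ee : is_edge d by rewrite /is_edge d_s orbT.
  have lt_d := is_edge_lt triP Ee.
  have Ed1 : d = mkedge d.1 d.2 by rewrite mkedge_lt ?(proj1 (andP lt_d)) //; case: (d).
  case/orP: Ed => /eqP du; [exists d.2 | exists d.1]; rewrite /adj -du 1?[mkedge d.2 _]mkedgeC -?Ed1 //.
have [_ x_n Nux] := adj_lt n3 triP ux.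
have Nsx : ~~ is_side n (mkedge u x).
  by case: triP => /allP/(_ _ xs)/and3P[].
have x0 : arc u x <> 0 by move=> h; apply: Nux; apply: (arc_inj n3 u_n u_n x_n); rewrite u0.
have xl := arc_ltn n3 u_n x_n.
have Nxw : x <> w.
  by move=> xw; move: Nsx; rewrite xw; case/negP; apply/(sideP n3 u_n w_n); left.
have Nxv : x <> v.
  by move=> xv; move: Nsx; rewrite xv; case/negP; apply/(sideP n3 u_n v_n); right.
have x1 : arc u x <> arc u w by move=> h; apply: Nxw; apply: (arc_inj n3 u_n x_n w_n).
have x2 : arc u x <> arc u v by move=> h; apply: Nxv; apply: (arc_inj n3 u_n x_n v_n).
by apply: (noncrossing_rel n3 triP u_n ux wv); lia.
Qed.

Lemma tri_cut u w v t : inner u w v -> t \in triangles n s ->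
  follows (mkedge u w) (mkedge u v) (tri_cycle t) ->
  cut_cycle (mkedge u w) (tri_cycle t) = (mkedge u v, [:: mkedge w v; mkedge u w]).
Proof.
move=> I t_tri fol; have [_ Ec cyc _] := tri_cycleP n3 triP t_tri.
have /andP[e_c /eqP f_c] := fol.
have [_ _ _ f_t _] := cut_cycleP e_c Ec cyc; rewrite f_c in f_t; move: e_c f_t f_c.
have [_ _ _ [? ? ?]] := turn_lt n3 triP (or_introl I : turn u w v).
case: t t_tri {fol Ec cyc} => -[p q] r; rewrite mem_filter => /andP[/and5P[pq qr _ _ _] _].
have [N1 N2 N3] : [/\ ((p, q) == (p, r)) = false, ((p, q) == (q, r)) = false & ((p, r) == (q, r)) = false].
  by rewrite !xpair_eqE; split; lia.
have pqE := mkedge_lt pq; have qrE := mkedge_lt qr; have prE := mkedge_lt (ltn_trans pq qr).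
have [N1' N2' N3'] : [/\ ((p, r) == (p, q)) = false, ((q, r) == (p, q)) = false & ((q, r) == (p, r)) = false].
  by rewrite eq_sym N1 eq_sym N2 eq_sym N3.
rewrite !inE => /or3P[] /eqP E1 /or3P[] /eqP E2; rewrite E1 E2 /cut_cycle /= ?eqxx ?N1 ?N2 ?N3 ?N1' ?N2' ?N3' /=;
  move=> E3; try (by move: E3 => /eqP; rewrite ?N1 ?N2 ?N3 ?N1' ?N2' ?N3').
- congr (_, [:: _; _]); rewrite -qrE; move: E1 E2; rewrite -pqE -prE => /mkedge_inj E1 /mkedge_inj E2.
  by rewrite /mkedge; congr (_, _); lia.
- congr (_, [:: _; _]); rewrite -pqE; move: E1 E2; rewrite -qrE -prE => /mkedge_inj E1 /mkedge_inj E2.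
  by rewrite /mkedge; congr (_, _); lia.
- congr (_, [:: _; _]); rewrite -prE; move: E1 E2; rewrite -qrE -pqE => /mkedge_inj E1 /mkedge_inj E2.
  by rewrite /mkedge; congr (_, _); lia.
Qed.

(** An internal arrow lies in exactly one triangle and, when its vertex carries a diagonal, in
    exactly one big cycle, so the derivative has two terms. *)
Lemma wrelE u w v : inner u w v -> has_diag s u ->
  wrel K n s (mkedge u w) (mkedge u v) =
    [:: (1%R, (mkedge u v, [:: mkedge w v; mkedge u w]));
        ((-1)%R, cut_cycle (mkedge u w) (big_cycle n s u))].
Proof.
move=> I hd; have [t t_tri fol] := tri_cycle_follows n3 triP I.
have [u_n _ _ _] := turn_lt n3 triP (or_introl I : turn u w v).
rewrite /wrel /potential map_cat flatten_cat -!map_comp.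
rewrite (@flatten_single _ _ _ (triangles n s) t (1%R, (mkedge u v, [:: mkedge w v; mkedge u w]))) //.
- rewrite (@flatten_single _ _ _ _ u ((-1)%R, cut_cycle (mkedge u w) (big_cycle n s u))) //.
  + by rewrite filter_uniq // iota_uniq.
  + by rewrite mem_filter hd mem_iota.
  + move=> u'; rewrite mem_filter mem_iota => /andP[hd' u'_n].
    have [Uc _ _ _] := big_cycleP n3 triP u'_n hd'.
    by rewrite /= cyc_deriv_uniq // (big_cycle_follows n3 triP I) //; case: eqP => // ->.
- rewrite filter_uniq // allpairs_uniq ?iota_uniq //; last by move=> [? ?] [? ?] _ _ [-> ->].
  by rewrite allpairs_uniq ?iota_uniq //; move=> [? ?] [? ?] _ _ [-> ->].
- move=> t' t'_tri; have [Uc _ _ _] := tri_cycleP n3 triP t'_tri.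
  rewrite /= cyc_deriv_uniq // fol //; case: eqP => // ->; congr [:: (_, _)].
  by apply: tri_cut; rewrite ?fol.
Qed.
End Relations.

(** * Parallel paths of equal theta-length are congruent *)

Section Parallel.
Variables (K : fieldType) (n : nat) (s : seq pvert).
Hypotheses (n3 : 3 <= n) (triP : triangulation n s).

Local Notation arc := (carc n).
Local Notation adj := (adj n s).
Local Notation turn := (turn n s).
Local Notation inner := (inner n s).
Local Notation is_arrow := (is_arrow n s).
Local Notation is_edge := (is_edge n s).
Local Notation theta := (theta n s).
Local Notation valid_path := (valid_path n s).
Local Notation dist := (dist n).
Local Notation connects := (connects n s).

(* Each generator of [J] is a difference of two paths, so congruence of paths
   modulo [J] is a purely combinatorial rewriting relation. *)
Inductive sim : qpath -> qpath -> Prop :=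
| sim_rel r e f q A B of valid_path r & valid_path q & rel_arrow n s e f &
    wrel K n s e f = [:: (1%R, A); ((-1)%R, B)] &
    [/\ tgt r = A.1, tgt r = B.1, tgt A = q.1 & tgt B = q.1] :
    sim (pcat (pcat r A) q) (pcat (pcat r B) q)
| sim_refl p : sim p p
| sim_sym p q of sim p q : sim q p
| sim_trans p q r of sim p q & sim q r : sim p r.

Lemma sim_pcat p q b : sim p q -> valid_path b -> tgt p = b.1 ->
  sim (pcat p b) (pcat q b).
Proof.
move=> pq vb pb.
have tgt_pq p1 q1 : sim p1 q1 -> tgt p1 = tgt q1.
  elim=> {p1 q1} [r e f q1 A B _ _ _ _ [rA rB Aq Bq] | // | p1 q1 _ -> // | p1 q1 r _ -> _ -> //].
  by rewrite !tgt_pcat // tgt_pcat.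
elim: pq pb => {p q} [r e f q A B vr vq ar W [rA rB Aq Bq] qb | p _ | p q pq IH pb | p q r pq IH qr IH' pb].
- rewrite !tgt_pcat ?tgt_pcat // in qb.
  have pcatA x : pcat (pcat (pcat r x) q) b = pcat (pcat r x) (pcat q b).
    by rewrite /pcat /= -!catA.
  by rewrite !pcatA; apply: sim_rel W _ => //; apply: valid_pcat.
- exact: sim_refl.
- by apply: sim_sym; apply: IH; rewrite (tgt_pq _ _ pq).
- by apply: sim_trans (IH pb) (IH' _); rewrite -(tgt_pq _ _ pq).
Qed.

Lemma connects_rcons i xs k N : connects i k N (i, rcons xs k) ->
  let e := last i xs in
  [/\ is_arrow e k, theta e k <= N & connects i e (N - theta e k) (i, xs)].
Proof.
case; rewrite valid_rcons theta_len_rcons => /andP[vp ar] _ _ <- /=.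
by rewrite leq_addl; split=> //; split=> //; rewrite addnK.
Qed.

Lemma sim_rcons i k xs ys : is_arrow (last i xs) k -> sim (i, xs) (i, ys) ->
  sim (i, rcons xs k) (i, rcons ys k).
Proof.
move=> ar pq; rewrite -!cats1.
apply: (@sim_pcat (i, xs) (i, ys) (last i xs, [:: k])) => //.
by rewrite /valid_path /= ar; case: (arrow_edge n3 triP ar) => ->.
Qed.

Lemma cut_cycle_sub e c x : x \in (cut_cycle e c).2 -> x \in c.
Proof. by rewrite /cut_cycle => /mem_behead; rewrite mem_rot. Qed.

(** By induction [xs] may be replaced by a path ending with [{v, w} -> {u, w}]. The whole path then
    ends with what remains of the triangle without the arrow [{v, u} -> {v, w}]. The relation of
    that arrow exchanges it for the rest of the big cycle around [v], whose last arrow is the one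
    from [{v, w'}]; induction then reaches [ys]. *)
Lemma sim_diamond u w v w' i xs ys N :
  (forall M xs ys k, M < N -> connects i k M (i, xs) -> connects i k M (i, ys) -> sim (i, xs) (i, ys)) ->
  inner u w v -> turn v w' u ->
  connects i (mkedge u w) (N - arc w v) (i, xs) -> arc w v <= N ->
  connects i (mkedge v w') (N - arc w' u) (i, ys) -> arc w' u <= N ->
  dist i (mkedge v w) + arc w v + arc v u <= N ->
  sim (i, rcons xs (mkedge u v)) (i, rcons ys (mkedge u v)).
Proof.
move=> IH I T cx le_x cy le_y le_N.
have [u_n w_n v_n [Nuw Nuv Nwv]] := turn_lt n3 triP (or_introl I : turn u w v).
have [_ w'_n _ [Nvw' _ Nw'u]] := turn_lt n3 triP T.
have J : inner v u w by apply: (inner_rot n3); apply: (inner_rot n3).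
have H : inner w v u by apply: (inner_rot n3).
have TJ : turn v u w by left.
(* The derivative of an arrow between two sides is not a relation; the incoming turn [T] around [v]
   rules this case out. *)
have Nears : ~~ (is_side n (mkedge v u) && is_side n (mkedge v w)).
  by apply/negP=> ears; case: (ear_no_turn n3 triP J ears T).
have hd := inner_has_diag n3 J Nears.
have W := wrelE K n3 triP J hd.
have [_ uw wv _] := I.
have Ei : is_edge i by case: cx => /valid_src.
have th_tri : arc w v + arc v u + arc u w = n.
  have /andP[w0 lt_w] := inner_rel n3 triP I; have u0 := arcnn n3 u.
  have := arc_le n3 u_n w_n v_n; have := arc_gt n3 u_n v_n u_n; lia.
have c_big : connects (mkedge v w) (mkedge v u) (n - arc u w) (cut_cycle (mkedge v u) (big_cycle n s v)).
  have [_ Ec cyc lt] := big_cycleP n3 triP v_n hd.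
  have fol : follows (mkedge v u) (mkedge v w) (big_cycle n s v).
    by rewrite (big_cycle_follows n3 triP J) // eqxx.
  have /andP[e_c /eqP f_c] := fol.
  have [vB tB _ _] := cut_cycleP e_c Ec cyc; rewrite f_c lt (thetaE n3 triP TJ) => th.
  by split=> //; clear -th; lia.
have Evw : is_edge (mkedge v w) by rewrite mkedgeC.
(* The inequality supplied by [diamond] leaves enough length for a path to [{v, w}], and the length
   of [xs] gives the congruence modulo [n]. *)
have [[i' rs] [vr /= ri tr thr]] : exists r, connects i (mkedge v w) (N - (arc w v + arc v u)) r.
  apply: (exists_path n3 triP) => //; first by lia.
  apply/eqP; rewrite -(eqn_modDr (weight i)).
  rewrite (dist_weight n3 triP) //.
  have [vx _ tx thx] := cx; have := theta_len_weight n3 triP vx; rewrite thx /= tx !(weight_mkedge n3).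
  have -> : N - arc w v = arc v u + (N - (arc w v + arc v u)) by lia.
  move=> /eqP; rewrite -(modnDml u) -(arc_mod n3 v_n u_n) modnDml -!addnA eqn_modDl.
  by rewrite addnA.
subst i'; have cr : connects i (mkedge v w) (N - (arc w v + arc v u)) (i, rs) by [].
have ar_wu : is_arrow (mkedge v w) (mkedge u w).
  by rewrite [mkedge v w]mkedgeC [mkedge u w]mkedgeC; apply: (turn_arrow n3 triP); left.
have ar_uv : is_arrow (mkedge u w) (mkedge u v) by apply: (turn_arrow n3 triP); left.
have w_v := arc_gt0 n3 w_n v_n Nwv; have w'_u := arc_gt0 n3 w'_n u_n Nw'u.
have lt_x : N - arc w v < N by clear -w_v le_x; lia.
have lt_y : N - arc w' u < N by clear -w'_u le_y; lia.
have sim1 : sim (i, xs) (i, rcons rs (mkedge u w)).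
  apply: (IH _ _ _ _ lt_x cx).
  split=> //; first by rewrite valid_rcons vr /= -/(tgt (i, rs)) tr.
    by rewrite /tgt /= last_rcons.
  rewrite theta_len_rcons thr -/(tgt (i, rs)) tr [mkedge v w]mkedgeC [mkedge u w]mkedgeC.
  by rewrite (thetaE n3 triP (or_introl H)); clear -le_N; lia.
have last_xs : last i xs = mkedge u w by case: cx.
have last_ys : last i ys = mkedge v w' by case: cy.
apply: sim_trans (sim_rcons _ sim1) _; first by rewrite last_xs.
have sub_B x : x \in (cut_cycle (mkedge v u) (big_cycle n s v)).2 -> x \in big_cycle n s v.
  exact: cut_cycle_sub.
set B := cut_cycle _ _ in W c_big sub_B; clearbody B.
have [vB fB tB thB] := c_big.
have {W} := @sim_rel (i, rs) (mkedge v u) (mkedge v w) (mkedge v u, [::]) _ B vr _ _ W.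
rewrite /rel_arrow Nears (turn_arrow n3 triP TJ) [valid_path _]andbT tr fB tB => simW.
have {simW} := simW _ isT; rewrite [is_edge _](_ : _ = true); last by rewrite mkedgeC; case: I.
move=> /(_ isT) simW; have {simW} := simW (And4 erefl erefl erefl erefl).
rewrite /pcat /= !cats0 -cat_rcons cats1 [mkedge v u]mkedgeC => simW.
apply: sim_trans simW _; apply: sim_sym.
have [bs EB] : exists bs, B.2 = rcons bs (mkedge u v).
  have : tgt B = mkedge u v by rewrite tB mkedgeC.
  rewrite /tgt fB; case/lastP: (B.2) => [/= Evu | bs z].
    by case/mkedge_inj: Evu => -[] // _ wu; case: Nuw.
  by rewrite last_rcons => ->; exists bs.
have cB : connects i (mkedge u v) N (i, rcons (rs ++ bs) (mkedge u v)).
  have -> : (i, rcons (rs ++ bs) (mkedge u v)) = pcat (i, rs) B by rewrite /pcat EB rcons_cat.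
  have -> : N = N - (arc w v + arc v u) + (n - arc u w) by clear -le_N th_tri; lia.
  by rewrite mkedgeC; apply: connects_pcat cr c_big.
have [ar_last le_last c_last] := connects_rcons cB.
(* The vertex before the target is still an edge at [v], even when [bs] is empty and it is [{v, w}].
   So the final arrow turns around [v], and [turn_inj] identifies its source as [{v, w'}]. *)
have last_bs : last i (rs ++ bs) \in big_cycle n s v.
  have [_ _ tr' _] := cr; rewrite last_cat [last i rs]tr'.
  case/lastP: bs EB {cB ar_last le_last c_last} => [_ /= | bs z EB].
    by rewrite (mem_big_cycle n3 v_n) // ?[adj _ _]Evw //; apply/eqP; rewrite eq_sym; apply/eqP.
  rewrite last_rcons; apply: sub_B; rewrite EB.
  by rewrite mem_rcons inE mem_rcons mem_head orbT.
have [z _ Ez] := big_cycle_inv last_bs.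
move: ar_last le_last c_last; rewrite Ez [mkedge u v]mkedgeC => ar_last le_last.
have Tz := turn_of_arrow n3 triP ar_last; have zw' := turn_inj n3 triP Tz T; subst z.
rewrite (thetaE n3 triP T) => c_last.
rewrite EB -rcons_cat [mkedge u v]mkedgeC; apply: sim_rcons; first by rewrite last_ys.
exact: IH lt_y cy c_last.
Qed.

Theorem parallel_sim i k N xs ys :
  connects i k N (i, xs) -> connects i k N (i, ys) -> sim (i, xs) (i, ys).
Proof.
elim/ltn_ind: N => N IH in k xs ys *.
case/lastP: xs => [|xs z] cx.
  case/lastP: ys => [|ys z] cy; first exact: sim_refl.
  have Ez : z = k by case: cy => _ _; rewrite /tgt /= last_rcons.
  subst z; have [ar le_N _] := connects_rcons cy; have := theta_gt0 n3 triP ar.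
  by have [_ _ _ N0] := cx; rewrite -N0 /theta_len /= in le_N; lia.
have Ez : z = k by case: cx => _ _; rewrite /tgt /= last_rcons.
subst z; have [ar le_N cx'] := connects_rcons cx.
case/lastP: ys => [|ys z] cy.
  have := theta_gt0 n3 triP ar.
  by have [_ _ _ N0] := cy; rewrite -N0 /theta_len /= in le_N; lia.
have Ez : z = k by case: cy => _ _; rewrite /tgt /= last_rcons.
subst z; have [ar' le_N' cy'] := connects_rcons cy.
have IH' M xs0 ys0 k0 : M < N -> connects i k0 M (i, xs0) -> connects i k0 M (i, ys0) ->
  sim (i, xs0) (i, ys0) by move=> lt_M; apply: IH.
have pos := theta_gt0 n3 triP ar.
have [e1 | Ne] := eqVneq (last i xs) (last i ys).
  apply: sim_rcons => //; rewrite -e1 in cy'; apply: IH' cx' cy'; lia.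
have [u [w [v [T E1 Ek]]]] := (is_arrowP n3 triP _ _).1 ar.
have [v1 [w' [u1 [T' E2 Ek']]]] := (is_arrowP n3 triP _ _).1 ar'.
have [_ _ _ [_ Nuv _]] := turn_lt n3 triP T.
(* Different last arrows into the same edge turn around its two different ends; around the same end
   they would coincide by [turn_inj]. *)
have [Eu Ev] : u1 = u /\ v1 = v.
  move: Ek'; rewrite Ek => /mkedge_inj[] [Eu Ev] //; subst u1 v1.
  by case/eqP: Ne; rewrite E1 E2 (turn_inj n3 triP T T').
subst u1 v1 k; rewrite E1 (thetaE n3 triP T) in cx' le_N pos.
rewrite E2 Ek' (thetaE n3 triP T') in cy' le_N'.
have Ei : is_edge i by case: cx => /valid_src.
have [x [y Exy]] := is_edgeE triP Ei.
have dx := theta_len_ge n3 triP (let: And4 vx _ _ _ := cx' in vx).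
have dy := theta_len_ge n3 triP (let: And4 vx _ _ _ := cy' in vx).
have [_ _ tx thx] := cx'; have [_ _ ty thy] := cy'.
rewrite tx thx /= in dx; rewrite ty thy /= in dy.
have xy : adj x y by rewrite /adj -Exy.
rewrite Exy in dx dy.
have D1 : dist (mkedge x y) (mkedge u w) + arc w v <= N by lia.
have D2 : dist (mkedge x y) (mkedge v w') + arc w' u <= N by lia.
case: (diamond n3 triP T T' xy D1 D2); rewrite -Exy => -[I le_D].
- exact: (sim_diamond IH' I T' cx' le_N cy' le_N' le_D).
- by apply: sim_sym; rewrite Ek'; apply: (sim_diamond IH' I T cy' le_N' cx' le_N le_D).
Qed.
End Parallel.

Import GRing.Theory.

(** * Membership in the ideal, and theta-homogeneity of its generators *)

Section Ideal.
Variables (K : fieldType) (n : nat) (s : seq pvert).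
Hypotheses (n3 : 3 <= n) (triP : triangulation n s).
Local Open Scope ring_scope.

Lemma path_coef_cons (x : K * qpath) u p : coef (x :: u) p = (if x.2 == p then x.1 else 0) + coef u p.
Proof. by rewrite /coef big_cons; case: ifP; rewrite ?add0r. Qed.

Lemma path_coef_cat (u v : seq (K * qpath)) p : coef (u ++ v) p = coef u p + coef v p.
Proof. by rewrite /coef big_cat. Qed.

Lemma path_coef_scale c (u : seq (K * qpath)) p :
  coef [seq (c * y.1, y.2) | y <- u] p = c * coef u p.
Proof. by rewrite /coef big_map mulr_sumr. Qed.

(** The kernel condition of [Gamma_iso_tiled]. Coefficients are compared because different lists may
    stand for the same element of the path algebra. *)
Definition in_ideal (u : seq (K * qpath)) : Prop :=
  exists g, @valid_gens K n s g /\ forall p, coef u p = coef (@jelem K n s g) p.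

Lemma in_ideal_eq u v : coef u =1 coef v -> in_ideal u -> in_ideal v.
Proof. by move=> uv [g [vg Eg]]; exists g; split=> // p; rewrite -uv. Qed.

Lemma in_ideal_nil : in_ideal [::].
Proof. by exists [::]. Qed.

Lemma in_ideal_cat u v : in_ideal u -> in_ideal v -> in_ideal (u ++ v).
Proof.
move=> [g [vg Eg]] [h [vh Eh]]; exists (g ++ h); split; first by rewrite /valid_gens all_cat; apply/andP.
by move=> p; rewrite /jelem map_cat flatten_cat !path_coef_cat Eg Eh.
Qed.

Lemma in_ideal_scale c u : in_ideal u -> in_ideal [seq (c * y.1, y.2) | y <- u].
Proof.
move=> [g [vg Eg]].
exists [seq (let: (d, p, a, q) := x in (c * d, p, a, q)) | x <- g]; split.
  by rewrite /valid_gens all_map; apply: sub_all vg => -[[[d p] a] q].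
move=> r; rewrite path_coef_scale Eg -path_coef_scale /jelem map_flatten -!map_comp.
congr (coef (flatten _) r); apply: eq_map => -[[[d p] a] q] /=.
by rewrite -map_comp; apply: eq_map => y /=; rewrite mulrA.
Qed.

Lemma sim_in_ideal p q : sim K n s p q -> in_ideal [:: (1, p); (-1, q)].
Proof.
elim=> {p q} [r e f q A B vr vq ar W [rA rB Aq Bq] | p | p q _ IH | p q r _ IHq _ IHr].
- exists [:: (1, r, (e, f), q)]; split; first by rewrite /valid_gens /= vr vq ar.
  by move=> p; rewrite /jelem /= W /sandwich /= -rA -rB Aq Bq !eqxx /= !mul1r.
- apply: in_ideal_eq in_ideal_nil => r; rewrite !path_coef_cons /=.
  by case: eqP => _; rewrite ?add0r // addrA subrr add0r.
- apply: in_ideal_eq (in_ideal_scale (-1) IH) => r; rewrite !path_coef_cons /= mulr1 mulN1r opprK.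
  by rewrite addrCA.
- apply: in_ideal_eq (in_ideal_cat IHq IHr) => t; rewrite path_coef_cat !path_coef_cons /coef big_nil !addr0 /=.
  by case: (q == t); rewrite ?addr0 ?add0r // -addrA (addrA (-1)) addNr add0r.
Qed.

(** Both cycles through the arrow have theta-length [n], so the two terms of the relation are
    parallel paths of equal length. External arrows join two sides and are excluded by
    [rel_arrow]. *)
Lemma rel_arrowE e f : rel_arrow n s e f -> exists A B N,
  [/\ wrel K n s e f = [:: (1, A); (-1, B)], connects n s f e N A & connects n s f e N B].
Proof.
case/andP=> /(is_arrowP n3 triP)[u [w [v [T -> ->]]]] Nside.
have [u_n w_n v_n _] := turn_lt n3 triP T.
have th := thetaE n3 triP T.
case: T => [I | [_ _ _ uE vE]]; last first.
  by case/negP: Nside; apply/andP; split; apply/(sideP n3) => //; [right | left].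
have hd := inner_has_diag n3 I Nside.
exists (mkedge u v, [:: mkedge w v; mkedge u w]), (cut_cycle (mkedge u w) (big_cycle n s u)), (n - carc n w v)%N.
split; first exact: wrelE.
- have [t t_tri fol] := tri_cycle_follows n3 triP I.
  have F : follows (mkedge u w) (mkedge u v) (tri_cycle t) by rewrite fol // eqxx.
  rewrite -(tri_cut n3 triP I t_tri F); have /andP[e_c /eqP f_c] := F.
  have [_ Ec cyc lt] := tri_cycleP n3 triP t_tri.
  have [vA tA _ _] := cut_cycleP e_c Ec cyc; rewrite f_c lt th => thA.
  by split=> //; clear -thA; lia.
- have [_ Ec cyc lt] := big_cycleP n3 triP u_n hd.
  have F : follows (mkedge u w) (mkedge u v) (big_cycle n s u).
    by rewrite (big_cycle_follows n3 triP I) // eqxx.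
  have /andP[e_c /eqP f_c] := F.
  have [vA tA _ _] := cut_cycleP e_c Ec cyc; rewrite f_c lt th => thA.
  by split=> //; clear -thA; lia.
Qed.

Lemma min_cycleP e : is_edge n s e -> connects n s e e n (min_cycle n s e).
Proof.
move=> Ee; have [u [w [v [eE I]]]] := edge_inner n3 triP Ee.
have [t t_tri fol] := tri_cycle_follows n3 triP (inner_rot n3 (inner_rot n3 I)).
have := fol t t_tri; rewrite eqxx mkedgeC -eE => /andP[e_t _].
have has_e : has (fun t => e \in tri_cycle t) (triangles n s) by apply/hasP; exists t.
have := nth_find (0, 0, 0)%N has_e; rewrite /min_cycle.
have := mem_nth (0, 0, 0)%N (_ : (find (fun t => e \in tri_cycle t) (triangles n s) < size (triangles n s))%N).
rewrite -has_find has_e => /(_ isT); move: (nth _ _ _) => t0 t0_tri e_c.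
have [_ Ec cyc lt] := tri_cycleP n3 triP t0_tri.
have := lt; rewrite -(loop_theta_rot _ _ (index e (tri_cycle t0))).
have := cyc; rewrite -(rot_cycle (index e (tri_cycle t0))).
rewrite rot_index // [cycle _ _]/= => cyc' lt'; split=> //; last by rewrite /tgt /= last_rcons.
by rewrite /valid_path Ee.
Qed.
End Ideal.

Import GRing.Theory.

(** * The matrix representation, its kernel and its image *)

Section Representation.
Variables (K : fieldType) (n : nat) (s : seq pvert) (m : nat).
Variables (lab : 'I_m -> pvert) (ell : pvert -> pvert -> nat) (k : 'I_m).
Hypotheses (n3 : 3 <= n) (triP : triangulation n s) (lab_inj : injective lab).
Hypotheses (lab_edge : forall i, is_edge n s (lab i)).
Hypotheses (lab_surj : forall e, is_edge n s e -> exists i, lab i = e).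
Hypotheses (ellE : forall e f, is_edge n s e -> is_edge n s f -> ell e f = dist n e f).

Local Notation is_edge := (is_edge n s).
Local Notation theta := (theta n s).
Local Notation theta_len := (theta_len n s).
Local Notation valid_path := (valid_path n s).
Local Notation dist := (dist n).
Local Notation connects := (connects n s).

Definition idx (e : pvert) : 'I_m := odflt k [pick i | lab i == e].

Lemma labK i : idx (lab i) = i.
Proof.
by rewrite /idx; case: pickP => [j /eqP/lab_inj // | /(_ i)]; rewrite eqxx.
Qed.

Lemma idxK e : is_edge e -> lab (idx e) = e.
Proof. by move=> /lab_surj[i <-]; rewrite labK. Qed.

Lemma idx_eq e f : is_edge e -> is_edge f -> (idx e == idx f) = (e == f).
Proof.
by move=> Ee Ef; apply/eqP/eqP=> [h | -> //]; rewrite -(idxK Ee) h idxK.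
Qed.

Definition expo (e f : pvert) (N : nat) : nat :=
  (ell (lab k) e + N - ell (lab k) f) %/ n.

(** The truncated operations in [expo] are exact: the subtraction by the triangle inequality for
    [dist], the division because displacements agree with weight differences modulo [n]. *)
Lemma expoE e f N : is_edge e -> is_edge f -> dist e f <= N -> N = dist e f %[mod n] ->
  ell (lab k) e + N = ell (lab k) f + n * expo e f N.
Proof.
move=> Ee Ef le_N modN; have Ek := lab_edge k; rewrite /expo !ellE //.
have le_f : dist (lab k) f <= dist (lab k) e + N.
  by apply: leq_trans (dist_triangle n3 triP Ek Ee Ef) _; rewrite leq_add2l.
have dv : n %| dist (lab k) e + N - dist (lab k) f.
  rewrite -eqn_mod_dvd // -(eqn_modDr (weight (lab k))) (dist_weight n3 triP) //.
  rewrite addnAC -modnDml (dist_weight n3 triP) // modnDml -modnDmr modN modnDmr addnC.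
  by rewrite (dist_weight n3 triP).
by rewrite mulnC divnK // subnKC.
Qed.

Lemma expo_path e f N p : connects e f N p -> ell (lab k) e + N = ell (lab k) f + n * expo e f N.
Proof.
move=> [vp <- <- <-]; apply: expoE; rewrite ?valid_src ?(valid_tgt n3 triP) ?(theta_len_ge n3 triP) //.
exact: theta_len_dist.
Qed.

Local Open Scope ring_scope.

Definition Ev (e : pvert) : 'M[{poly K}]_m := delta_mx (idx e) (idx e).

Definition Av (e f : pvert) : 'M[{poly K}]_m :=
  'X^(expo e f (theta e f)) *: delta_mx (idx e) (idx f).

Lemma zip_rcons_path (T : Type) (e : T) xs f :
  zip (e :: rcons xs f) (rcons xs f) = rcons (zip (e :: xs) xs) (last e xs, f).
Proof. by elim: xs e => [|x xs IHxs] e //=; rewrite -IHxs. Qed.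

Lemma phi_path_rcons e xs f :
  phi_path Ev Av (e, rcons xs f) = phi_path Ev Av (e, xs) *m Av (last e xs) f.
Proof. by rewrite /phi_path [in LHS]/= zip_rcons_path foldl_rcons. Qed.

(** The exponents add along a path because the terms [ell (lab k) _] in [expo_path] telescope. *)
Lemma phi_pathE e f N p : connects e f N p ->
  phi_path Ev Av p = 'X^(expo e f N) *: delta_mx (idx e) (idx f).
Proof.
case: p => e' xs cp; have Ee' : e' = e by case: cp.
subst e'.
elim/last_ind: xs f N cp => [|xs z IHxs] f N cp.
  case: (cp) => Ee _ <- <-; by rewrite /phi_path /tgt /= /expo addKn div0n expr0 scale1r.
have Ez : z = f by case: cp => _ _; rewrite /tgt /= last_rcons.
subst z; have [ar le_N cp'] := connects_rcons cp.
rewrite phi_path_rcons (IHxs _ _ cp') /Av -scalemxAl -scalemxAr mul_delta_mx scalerA -exprD.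
congr ('X^_ *: _); apply/eqP; rewrite -(eqn_pmul2l (_ : 0 < n)%N); last by clear -n3; lia.
apply/eqP.
have c1 : connects (last e xs) f (theta (last e xs) f) (last e xs, [:: f]).
  have [El _] := arrow_edge n3 triP ar.
  by split; rewrite // /valid_path /= ?ar ?El // /theta_len /= addn0.
have := expo_path cp; have := expo_path cp'; have := expo_path c1.
by rewrite mulnDr; lia.
Qed.

Lemma Ev_Av_hom : path_alg_hom n s Ev Av.
Proof.
split=> [e f Ee Ef | | e f ar].
- rewrite /Ev mul_delta_mx_cond idx_eq //; case: eqP => [-> | _]; first by rewrite mulr1n.
  by rewrite mulr0n.
- have perm_edges : perm_eq (edges n s) [seq lab i | i <- enum 'I_m].
    apply: uniq_perm.
    + by rewrite filter_uniq // allpairs_uniq ?iota_uniq // => -[? ?] [? ?] _ _ [-> ->].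
    + by rewrite map_inj_uniq // enum_uniq.
    + move=> e; rewrite mem_filter; apply/andP/mapP=> [[Ee _] | [i _ ->]].
        by exists (idx e); rewrite ?idxK ?mem_enum.
      split; first exact: lab_edge.
      have := is_edge_lt triP (lab_edge i); case: (lab i) => a b /= ab_n.
      by apply/allpairsP; exists (a, b); split=> //=; rewrite mem_iota; clear -ab_n; lia.
  rewrite (perm_big _ perm_edges) big_map big_enum /= mx1_sum_delta.
  by apply: eq_bigr => i _; rewrite /Ev labK.
- by rewrite /Ev /Av -scalemxAr -scalemxAl !mul_delta_mx.
Qed.

Local Notation Phi := (phi Ev Av).

Lemma phi_cons x (u : seq (K * qpath)) : Phi (x :: u) = x.1%:P *: phi_path Ev Av x.2 + Phi u.
Proof. by rewrite /phi big_cons. Qed.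

Lemma phi_nil : Phi [::] = 0.
Proof. by rewrite /phi big_nil. Qed.

Lemma phi_cat (u v : seq (K * qpath)) : Phi (u ++ v) = Phi u + Phi v.
Proof. by rewrite /phi big_cat. Qed.

Lemma phi_scale c (u : seq (K * qpath)) :
  Phi [seq (c * y.1, y.2) | y <- u] = c%:P *: Phi u.
Proof.
rewrite /phi big_map scaler_sumr; apply: eq_bigr => x _.
by rewrite scalerA -polyCM.
Qed.

(** Grouping the terms by path shows that [phi] depends only on the element of the path algebra and
    not on the list. *)
Lemma phi_coef (S : seq qpath) (u : seq (K * qpath)) : uniq S -> {subset map snd u <= S} ->
  Phi u = \sum_(p <- S) (coef u p)%:P *: phi_path Ev Av p.
Proof.
move=> US; elim: u => [|x u IHu] sub_S.
  by rewrite phi_nil big1 // => p _; rewrite /coef big_nil scale0r.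
rewrite phi_cons IHu => [|p p_u]; last by apply: sub_S; rewrite inE p_u orbT.
under [RHS]eq_bigr => p _ do rewrite path_coef_cons polyCD scalerDl.
rewrite big_split /=; congr (_ + _).
rewrite (bigD1_seq x.2) ?eqxx //=; last by apply: sub_S; rewrite mem_head.
by rewrite big1 ?addr0 // => p /negPf; rewrite eq_sym => ->; rewrite scale0r.
Qed.

Lemma phi_eq_coef (u v : seq (K * qpath)) : coef u =1 coef v -> Phi u = Phi v.
Proof.
move=> uv; pose S := undup (map snd (u ++ v)).
rewrite !(@phi_coef S) ?undup_uniq //; try by move=> p; rewrite mem_undup map_cat mem_cat => ->; rewrite ?orbT.
by apply: eq_bigr => p _; rewrite uv.
Qed.

Lemma phi_jelem g : @valid_gens K n s g -> Phi (@jelem K n s g) = 0.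
Proof.
elim: g => [|[[[c r] [e f]] q] g IHg]; first by rewrite phi_nil.
case/andP=> /and3P[vr vq ar] vg; rewrite /jelem /= phi_cat IHg // addr0 phi_scale.
have [A [B [N [-> [vA A1 A2 A3] [vB B1 B2 B3]]]]] := rel_arrowE K n3 triP ar.
rewrite /sandwich /= A1 B1 A2 B2 /=; case: (boolP ((tgt r == f) && (e == q.1))) => [/andP[/eqP r2 /eqP q1] | _] /=; last by rewrite [phi _ _ _](_ : _ = 0) ?scaler0 //; apply: phi_nil.
have conn C : connects f e N C -> connects r.1 (tgt q) (theta_len r + N + theta_len q)%N (pcat (pcat r C) q).
  move=> cC; apply: (@connects_pcat _ _ _ e); last by split.
  by apply: connects_pcat cC; split.
rewrite !phi_cons phi_nil addr0 /= !(phi_pathE (conn _ _)) //.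
by rewrite -scalerDl -polyCD subrr scale0r scaler0.
Qed.

Definition same_class (p q : qpath) : bool :=
  [&& p.1 == q.1, tgt p == tgt q & theta_len p == theta_len q].

Lemma same_class_sim p q : valid_path p -> valid_path q -> same_class p q -> sim K n s p q.
Proof.
case: p q => [e xs] [e' ys] vp vq /and3P[/eqP /= e_e' /eqP tpq /eqP thpq]; subst e'.
by apply: (parallel_sim K n3 triP) (_ : connects e (tgt (e, xs)) (theta_len (e, xs)) _) _.
Qed.

(** The matrix position recovers the ends of a path and the exponent recovers its length, so path
    classes have linearly independent images. *)
Lemma coef_phi_path p q : valid_path p -> valid_path q ->
  (phi_path Ev Av q (idx p.1) (idx (tgt p)))`_(expo p.1 (tgt p) (theta_len p)) = (same_class p q)%:R.
Proof.
move=> vp vq; have cp : connects p.1 (tgt p) (theta_len p) p by [].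
have cq : connects q.1 (tgt q) (theta_len q) q by [].
rewrite (phi_pathE cq) !mxE /same_class !idx_eq ?valid_src ?(valid_tgt n3 triP) //.
case: eqP => [p1 | _] /=; last by rewrite mulr0 coef0.
case: eqP => [p2 | _] /=; last by rewrite mulr0 coef0.
rewrite mulr1 coefXn; congr (_%:R); congr nat_of_bool.
have := expo_path cp; have := expo_path cq; rewrite -p1 -p2.
have n0 : (0 < n)%N by clear -n3; lia.
move=> E1 E2; apply/eqP/eqP=> [h | -> //].
by rewrite h in E2; apply/eqP; rewrite -(eqn_add2l (ell (lab k) p.1)) E1 E2.
Qed.

Lemma phi_ker (u : seq (K * qpath)) : all (fun x => valid_path x.2) u -> Phi u = 0 -> in_ideal n s u.
Proof.
have [l le_l] := ubnP (size u); elim: l => // l IHl in u le_l *.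
case: u le_l => [|[c p] u] /= le_l; first by move=> _ _; apply: in_ideal_nil.
move=> /andP[vp vu] phi0.
case: (boolP (has (fun x => same_class p x.2) u)) => [/hasP[[d q] q_u /= pq] | /hasPn alone].
  case/splitPr: q_u le_l vu phi0 => u1 u2 le_l vu phi0.
  have vq : valid_path q by move: vu; rewrite all_cat /= => /and3P[].
  have s_pq := sim_in_ideal (same_class_sim vp vq pq).
  (* Modulo the ideal the coefficient of [p] is moved onto the congruent path [q], which shortens
     the combination by one term. *)
  have eq_u : coef ([:: (c * 1, p); (c * -1, q)] ++ (u1 ++ (c + d, q) :: u2)) =1
      coef ((c, p) :: u1 ++ (d, q) :: u2).
    move=> r; rewrite !(path_coef_cat, path_coef_cons) /= mulr1 mulrN1 /coef big_nil addr0.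
    case: (q == r); last by rewrite !add0r addr0.
    by rewrite -addrA; congr (_ + _); rewrite addrCA; congr (_ + _); rewrite -addrA addKr.
  have c_pq := in_ideal_scale c s_pq; have [g [vg Eg]] := c_pq.
  have phi_pq : Phi [:: (c * 1, p); (c * -1, q)] = 0 by rewrite (phi_eq_coef Eg) phi_jelem.
  apply: (in_ideal_eq eq_u); apply: in_ideal_cat => //; apply: IHl.
  - by move: le_l; rewrite !size_cat /=; clear; lia.
  - by move: vu; rewrite !all_cat.
  - by have := phi_eq_coef eq_u; rewrite phi_cat phi_pq add0r phi0.
(* No other term is in the class of [p], so [c] is itself a coefficient of an entry of the zero
   matrix. *)
have c0 : c = 0.
  have := congr1 (fun M : 'M[{poly K}]_m => (M (idx p.1) (idx (tgt p)))`_(expo p.1 (tgt p) (theta_len p))) phi0.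
  rewrite mxE coef0 phi_cons /= mxE coefD mxE coefCM coef_phi_path // /same_class !eqxx mulr1.
  rewrite /phi summxE coef_sum big1_seq ?addr0 // => x /= x_u.
  rewrite mxE coefCM coef_phi_path ?(allP vu) // (negPf (alone _ x_u)) mulr0 //.
have eq_u : coef u =1 coef ((c, p) :: u) by move=> r; rewrite path_coef_cons /= c0; case: ifP; rewrite add0r.
apply: (in_ideal_eq eq_u); apply: IHl => //.
by rewrite (phi_eq_coef eq_u).
Qed.

Lemma phi_image M : tiled_order (dexp n lab ell k) M <->
  exists u : seq (K * qpath), all (fun x => valid_path x.2) u /\ Phi u = M.
Proof.
split; last first.
  case=> u [vu <-] i j; rewrite /phi summxE.
  rewrite big_seq; apply: (big_ind (fun P => 'X^_ %| P)); [exact: dvdp0 | by move=> *; apply: dvdp_add |].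
  move=> x x_u; have vx := allP vu _ x_u.
  have cx : connects x.2.1 (tgt x.2) (theta_len x.2) x.2 by [].
  rewrite (phi_pathE cx) !mxE; case: andP => [[/eqP-> /eqP->] | _]; last by rewrite !mulr0 dvdp0.
  rewrite mulr1 dvdp_mull // dvdp_exp2l // /dexp !idxK ?valid_src ?(valid_tgt n3 triP) //.
  rewrite /expo leq_div2r // leq_sub2r // leq_add2l ellE ?valid_src ?(valid_tgt n3 triP) //.
  exact: (theta_len_ge n3 triP).
move=> tM; pose Im M := exists u : seq (K * qpath), all (fun x => valid_path x.2) u /\ Phi u = M.
have ImD A B : Im A -> Im B -> Im (A + B).
  by case=> u [vu <-] [v [vv <-]]; exists (u ++ v); rewrite all_cat vu vv phi_cat.
have Im0 : Im 0 by exists [::]; rewrite phi_nil.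
rewrite (matrix_sum_delta M) -/(Im _).
apply: big_ind => // i _; apply: big_ind => // j _.
have /dvdpP[Q ->] := tM i j.
rewrite -(coefK Q) poly_def mulr_suml scaler_suml; apply: big_ind => // t _.
have Ei := lab_edge i; have Ej := lab_edge j; have Ek := lab_edge k.
(* A minimal path gives the exponent [dexp], and each additional [n] in its length multiplies the
   image by one more ['X]. *)
have [||p cp] := exists_path n3 triP Ei Ej (N := dist (lab i) (lab j) + t * n).
- exact: leq_addr.
- by rewrite addnC modnMDl.
exists [:: (Q`_t, p)]; rewrite /= phi_cons phi_nil addr0 /= (phi_pathE cp) !labK.
case: (cp) => -> _ _ _; split=> //.
rewrite !scalerA -mul_polyC -mulrA -exprD; congr ((_ * 'X^_) *: _).
have n0 : (0 < n)%N by clear -n3; lia.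
rewrite /expo /dexp !ellE //; have tr := dist_triangle n3 triP Ek Ei Ej.
by rewrite addnA -addnBAC // [(_ - _ + _)%N]addnC divnMDl // addnC.
Qed.

(** A minimal cycle at [e] has theta-length [n], hence exponent 1 at the diagonal position of
    [e]. *)
Lemma phi_C : Phi (@Cfs K n s) = ('X : {poly K})%:M.
Proof.
rewrite /phi /Cfs big_map; have [_ sum1 _] := Ev_Av_hom.
rewrite -[RHS]scalemx1 -sum1 scaler_sumr big_seq [RHS]big_seq; apply: eq_bigr => e.
rewrite mem_filter => /andP[Ee _] /=; have cm := min_cycleP n3 triP Ee.
rewrite scale1r (phi_pathE cm) /Ev.
have n0 : (0 < n)%N by clear -n3; lia.
by rewrite /expo addnC addnK divnn n0 expr1.
Qed.

Lemma representation_iso : Gamma_iso_tiled K n s (dexp n lab ell k).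
Proof.
exists Ev, Av; split.
- exact: Ev_Av_hom.
- move=> u vu; split; first exact: phi_ker.
  by case=> g [vg /phi_eq_coef->]; apply: phi_jelem.
- exact: phi_image.
- exact: phi_C.
Qed.
End Representation.

(** The displacement bounds every path from below by [theta_len_ge] and is attained by
    [dist_path]. *)
Lemma min_theta_len_dist n s ell : 3 <= n -> triangulation n s -> min_theta_len n s ell ->
  forall e f, is_edge n s e -> is_edge n s f -> ell e f = dist n e f.
Proof.
move=> n3 triP ell_min e f Ee Ef; have [[p [vp pe pf thp]] le_ell] := ell_min e f Ee Ef.
have [q [vq qe qf thq]] := dist_path n3 triP Ee Ef.
apply/eqP; rewrite eqn_leq; apply/andP; split; first by rewrite -thq le_ell.
by have := theta_len_ge n3 triP vp; rewrite pe pf thp.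
Qed.

Theorem theorem2p24 (K : fieldType) (n : nat) (sigma : seq pvert)
  (lab : 'I_(n.*2 - 3) -> pvert) (ell : pvert -> pvert -> nat) :
  3 <= n ->
  triangulation n sigma ->
  injective lab ->
  (forall i, is_edge n sigma (lab i)) ->
  (forall e, is_edge n sigma e -> exists i, lab i = e) ->
  min_theta_len n sigma ell ->
  (forall k i j : 'I_(n.*2 - 3),
     n %| ell (lab k) (lab i) + ell (lab i) (lab j) - ell (lab k) (lab j)) /\
  (forall k : 'I_(n.*2 - 3), Gamma_iso_tiled K n sigma (dexp n lab ell k)).
Proof.
move=> n3 triP lab_inj lab_edge lab_surj ell_min.
have ellE := min_theta_len_dist n3 triP ell_min.
split=> [k i j | k]; last exact: representation_iso.
have Ek := lab_edge k; have Ei := lab_edge i; have Ej := lab_edge j.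
(* At the minimal length from [i] to [j], the exactness of [expo] is the required divisibility. *)
have := expoE k n3 triP lab_edge ellE Ei Ej (leqnn _) erefl.
by rewrite -[dist n _ _]ellE // => ->; rewrite addKn dvdn_mulr.
Qed.
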